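(* Let $f:S\to S$ be a generalized pseudo-Anosov homeomorphism with compatibility order $n(f)$. For every $n\ge n(f)$, the set $$\mathcal{T}(f,n):=\{T(f,\mathcal{R}):\mathcal{R}\in\mathcal{M}(f,n)\}$$ of primitive geometric types of $f$ of order $n$ is finite.
   Context: **Pseudo-Anosov maps.** A surface $S$ is a smooth closed oriented 2-manifold. A generalized pseudo-Anosov homeomorphism $f:S\to S$ is an orientation-preserving homeomorphism for which there are $\lambda>1$ and two $f$-invariant transverse measured singular foliations $(\mathcal{F}^s,\mu^s)$ (stable) and $(\mathcal{F}^u,\mu^u)$ (unstable), possibly with 1-prong singularities (spines), with $f_*\mu^s=\lambda\mu^s$, $f_*\mu^u=\lambda^{-1}\mu^u$; the convention is that $f$ stretches unstable arcs (measured by $\mu^s$) by $\lambda$ and contracts stable arcs (measured by $\mu^u$) by $\lambda^{-1}$. $\mathbf{Sing}(f)$ is the set of singularities of the foliations; if there are none (torus case), $\mathbf{Sing}(f)$ denotes a fixed nonempty finite $f$-invariant family of periodic points. $\mathcal{F}^{s}(p),\mathcal{F}^u(p)$ (also $F^s_p$, $F^u_p$) are the leaves through $p$ (for a singularity, including all its prongs); $\mathcal{F}^{s,u}(\mathbf{Sing}(f))$ is the union of these over $p\in\mathbf{Sing}(f)$. A stable (unstable) separatrix $F^s(p)$ ($F^u(p)$) of $p\in\mathbf{Sing}(f)$ is a connected component of $\mathcal{F}^s(p)\setminus\{p\}$ ($\mathcal{F}^u(p)\setminus\{p\}$); for $x$ on it, $[p,x]^s$ ($[p,x]^u$) is the arc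 from $p$ to $x$ in the leaf. A stable (unstable) interval is an arc in a stable (unstable) leaf. **First intersection points.** A point $x\notin\mathbf{Sing}(f)$ is a first intersection point of $f$ if there are $p,q\in\mathbf{Sing}(f)$, a stable separatrix $F^s(p)$ and an unstable separatrix $F^u(q)$ with $x\in F^s(p)\cap F^u(q)$ and $(p,x]^s\cap(q,x]^u=\{x\}$. **Rectangles.** For an open connected nonempty $r\subset S$ and $x\in r$, let $I_x$ (resp. $J_x$) be the closure of the connected component of $F^s_x\cap r$ (resp. $F^u_x\cap r$) containing $x$. The set $r$ is trivially bi-foliated if for all $x,y\in r$, $I_x$ and $J_y$ are homeomorphic to closed intervals and $I_x\cap J_y$ is a single point, lying in $r$. A rectangle $R$ is the closure of a trivially bi-foliated set. A parametrization of $R$ is a continuous map $\rho:[0,1]^2\to S$ with image $R$, restricting to an orientation-preserving homeomorphism from $(0,1)^2$ onto the interior $\overset{o}{R}:=\rho((0,1)^2)$, mapping each horizontal (vertical) segment homeomorphically onto an arc of a single stable (unstable) leaf, called a horizontal (vertical) leaf of $R$. $\partial^sR=\rho([0,1]\times\{0,1\})$, $\partial^uR=\rho(\{0,1\}\times[0,1])$; the two arcs of $\partial^uR$ are the $u$-boundary components. $R$ is embedded if $\rho$ is a homeomorphism onto its image. A rectangle $H\subset R$ is a horizontal (vertical) subrectangle if for every $x\in\overset{o}{H}$ the component of $\overset{o}{H}\cap F^s_x$ ($\overset{o}{H}\cap F^u_x$) containing $x$ equals that of $\overset{o}{R}\cap F^s_x$ ($\overset{o}{R}\cap F^u_x$).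 **Markov partitions.** A Markov partition for $f$ is a finite labeled family of rectangles $\mathcal{R}=\{R_i\}_{i=1}^N$ with $S=\bigcup R_i$, pairwise disjoint interiors $\overset{o}{R_i}$, and such that for all $i,j$ the closure of each nonempty component of $\overset{o}{R_i}\cap f^{-1}(\overset{o}{R_j})$ is a horizontal subrectangle of $R_i$ and the closure of each nonempty component of $f(\overset{o}{R_i})\cap\overset{o}{R_j}$ is a vertical subrectangle of $R_j$. **Geometric type.** A vertical direction on a rectangle is an orientation of its vertical leaves induced via a parametrization by one of the two orientations $\xi_v$ of the vertical lines of $[0,1]^2$; it determines the horizontal direction, induced by the orientation $\xi_h$ such that $(\xi_v,\xi_h)$ is the standard orientation of $\mathbb{R}^2$. A geometric rectangle is a rectangle with a chosen vertical direction; a geometric Markov partition is a Markov partition of geometric rectangles. Horizontal subrectangles of $(f,\mathcal{R})$ in $R_i$ are the closures of the components of $\overset{o}{R_i}\cap\bigcup_jf^{-1}(\overset{o}{R_j})$, labeled $H^i_1,\dots,H^i_{h_i}$ from bottom to top along the vertical direction of $R_i$; vertical subrectangles in $R_k$ are the closures of the components of $\overset{o}{R_k}\cap\bigcup_if(\overset{o}{R_i})$, labeled $V^k_1,\dots,V^k_{v_k}$ from left to right along the horizontal direction of $R_k$. Subrectangles inherit the directions of the ambient rectangle. Define $\rho(i,j)=(k,l)$ iff $f(H^i_j)=V^k_l$, and $\epsilon(i,j)=1$ if $f$ maps the vertical direction of $H^i_j$ to that of $V^k_l=f(H^i_j)$, $-1$ otherwise. The geometric type is $T(f,\mathcal{R})=(N,\{(h_i,v_i)\}_{i=1}^N,\rho,\epsilon)$.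 **Adapted graphs.** An $s$-graph adapted to $f$ is a finite family $\delta^s=\{I_i\}$ of nondegenerate compact stable intervals such that, with $\cup\delta^s:=\bigcup_iI_i$: $f(\cup\delta^s)\subset\cup\delta^s$; each $I_i$ lies in $\mathcal{F}^s(p)$ for some $p\in\mathbf{Sing}(f)$; for every $p\in\mathbf{Sing}(f)$ and every stable separatrix of $p$ some $I_i$ lies in that separatrix (together with $p$) and has $p$ as an endpoint; endpoints of each $I_i$ lie in $\mathcal{F}^u(\mathbf{Sing}(f))$. A $u$-graph adapted to $f$ is defined exchanging $s,u$ and $f,f^{-1}$. **Rails and compatibility.** The regular part $\overset{o}{\delta^s}$ is $\cup\delta^s$ minus all endpoints of its intervals. A regular $u$-rail of $\delta^s$ is an unstable interval with interior disjoint from $\cup\delta^s$ and endpoints in $\overset{o}{\delta^s}$. An extreme $u$-rail of $\delta^s$ is an unstable segment $J$ with at least one endpoint not in $\overset{o}{\delta^s}$ for which there is an embedded rectangle $R$ with $\partial^sR\subset\cup\delta^s$, $J$ a $u$-boundary component of $R$, and every other vertical leaf of $R$ a regular $u$-rail. $s$-rails of $\delta^u$ are defined by exchanging $s$ and $u$. $\delta^s$ and $\delta^u$ are compatible if endpoints of intervals of $\delta^s$ lie in $\cup\delta^u$, endpoints of intervals of $\delta^u$ lie in $\cup\delta^s$, extreme $u$-rails of $\delta^s$ are contained in $\cup\delta^u$, and extreme $s$-rails of $\delta^u$ are contained in $\cup\delta^s$. **Primitive partitions.** Let $z\in F^s(p)\cap F^u(q)$ be a first intersection point. Put $J^u(z)=[q,z]^u$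 and $\mathcal{J}^u(z)=\bigcup_{i\ge0}f^{-i}(J^u(z))$, a finite union of compact arcs, $f^{-1}$-invariant. Let $\delta^s(z)$ be the family of all stable segments with one endpoint in $\mathbf{Sing}(f)$, the other in $\mathcal{J}^u(z)$, and interior disjoint from $\mathcal{J}^u(z)$; it is an $s$-graph adapted to $f$. Let $\delta^u(z)$ be the family of all unstable segments with one endpoint in $\mathbf{Sing}(f)$, the other in $\cup\delta^s(z)$, and interior disjoint from $\cup\delta^s(z)$; it is a $u$-graph adapted to $f$. The compatibility coefficient $n(z)$ is the least natural number such that $\delta^s(z)$ and $f^n(\delta^u(z))$ are compatible for all $n\ge n(z)$. For $n\ge n(z)$, the primitive Markov partition $\mathcal{R}(z,n)$ generated by $z$ of order $n$ is the family of closures of the connected components of $S\setminus(\cup\delta^s(z)\cup\bigcup f^n(\delta^u(z)))$; it is a Markov partition for $f$. The compatibility order is $n(f)=\max\{n(z):z\text{ a first intersection point of }f\}$ (the maximum exists). For $n\ge n(f)$, $\mathcal{M}(f,n)=\{\mathcal{R}(z,n):z\text{ a first intersection point of }f\}$, where in forming $\mathcal{T}(f,n)$ each $\mathcal{R}(z,n)$ is considered with all possible labelings of its rectangles and choices of vertical directions. *)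

(* Defs.v *)
From HB Require Import structures.
From mathcomp Require Import all_boot all_order all_algebra.
From mathcomp Require Import all_classical all_reals all_analysis.

Set Implicit Arguments.
Unset Strict Implicit.
Unset Printing Implicit Defensive.

Import Order.TTheory GRing.Theory Num.Theory.
Import numFieldNormedType.Exports.

Local Open Scope classical_set_scope.
Local Open Scope ring_scope.

(** * Planar preliminaries *)

Definition smooth_scalar_upto (R : realType) :=
  fix Ck (k : nat) (O : set (R * R)) (h : R * R -> R) : Prop :=
    (forall u, O u -> {for u, continuous h}) /\
    match k with
    | 0%N => True
    | k'.+1 => forall v : R * R, v = (1, 0) \/ v = (0, 1) ->
        (forall u, O u -> derivable h u v) /\ Ck k' O ('D_v h)
    end.

Definition smooth_map (R : realType) (O : set (R * R)) (g : R * R -> R * R) :=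
  forall k, smooth_scalar_upto k O (fst \o g) /\
            smooth_scalar_upto k O (snd \o g).

Definition jacobian_det (R : realType) (g : R * R -> R * R) (u : R * R) : R :=
  'D_(1, 0) (fst \o g) u * 'D_(0, 1) (snd \o g) u
  - 'D_(0, 1) (fst \o g) u * 'D_(1, 0) (snd \o g) u.

(** [g] is a [2 * pi]-periodic loop in the punctured plane with winding number
    [1] around the origin: [theta] is a continuous determination of its angle. *)
Definition winds_once (R : realType) (g : R -> R * R) : Prop :=
  exists rho theta : R -> R, continuous theta /\
    forall t, [/\ 0 < rho t,
                  g t = (rho t * cos (theta t), rho t * sin (theta t)) &
                  theta (t + pi *+ 2) = theta t + pi *+ 2].

(** Local degree [1], for maps that are homeomorphisms onto their image near
    [u] but need not be differentiable. *)
Definition orientation_preserving_at (R : realType) (g : R * R -> R * R)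
    (u : R * R) : Prop :=
  \forall r \near (0 : R)^'+,
    winds_once (fun t => g (u.1 + r * cos t, u.2 + r * sin t) - g u).

Definition closed_square (R : realType) : set (R * R) :=
  [set u | (0 <= u.1 <= 1) /\ (0 <= u.2 <= 1)].
Definition open_square (R : realType) : set (R * R) :=
  [set u | (0 < u.1 < 1) /\ (0 < u.2 < 1)].

Definition dot (R : realType) (u v : R * R) : R := u.1 * v.1 + u.2 * v.2.

(** * Smooth closed oriented surfaces *)

Record chart (R : realType) (S : topologicalType) := Chart {
  cdom : set S;
  cmap : S -> R * R;
  cinv : R * R -> S }.

Definition is_chart (R : realType) (S : topologicalType) (c : chart R S) :=
  [/\ open (cdom c), open (cmap c @` cdom c),
      {within cdom c, continuous (cmap c)},
      {within cmap c @` cdom c, continuous (cinv c)} &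
      forall x, cdom c x -> cinv c (cmap c x) = x].

Definition closed_oriented_surface (R : realType) (S : topologicalType)
    (A : set (chart R S)) : Prop :=
  [/\ hausdorff_space S, compact [set: S],
      forall c, A c -> is_chart c,
      forall x, exists2 c, A c & cdom c x &
      forall c d, A c -> A d ->
        let O := cmap c @` (cdom c `&` cdom d) in
        let g := cmap d \o cinv c in
        smooth_map O g /\ (forall u, O u -> 0 < jacobian_det g u)].

Definition homeo (S : topologicalType) (f : S -> S) : Prop :=
  continuous f /\
  exists g : S -> S, [/\ continuous g, cancel f g & cancel g f].

Definition orientation_preserving (R : realType) (S : topologicalType)
    (A : set (chart R S)) (f : S -> S) : Prop :=
  forall c d x, A c -> A d -> cdom c x -> cdom d (f x) ->
    orientation_preserving_at (cmap d \o f \o cinv c) (cmap c x).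

Definition components (S : topologicalType) (O : set S) : set (set S) :=
  [set C | exists2 x, O x & C = connected_component O x].

(** * Arcs and leaves *)

Section Arcs.
Variables (R : realType) (S : topologicalType).

(** Leaves are usually dense in [S], so connectedness of subsets of a leaf
    always refers to the leaf topology.  Since a leaf is locally a union of
    plaques with totally disconnected transversal trace, components for the
    leaf topology are the path components in [S]. *)
Definition path_component (A : set S) (x : S) : set S :=
  [set y | exists g : R -> S,
    [/\ {within `[0, 1]%classic, continuous g},
        g @` `[0, 1]%classic `<=` A, g 0 = x & g 1 = y]].

Definition is_arc (I : set S) (x y : S) : Prop :=
  exists g : R -> S,
    [/\ {within `[0, 1]%classic, continuous g},
        {in `[0, 1] &, injective g},
        I = g @` `[0, 1]%classic, g 0 = x & g 1 = y].

Definition endpoints (I : set S) : set S := [set x | exists y, is_arc I x y].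
Definition arc_interior (I : set S) : set S := I `\` endpoints I.

(** A foliation is given by [F : S -> set S], with [F x] the leaf of [x]. *)
Definition leaf_arc (F : S -> set S) (I : set S) (x y : S) : Prop :=
  is_arc I x y /\ I `<=` F x.

Definition interval_of (F : S -> set S) (I : set S) : Prop :=
  exists x y, leaf_arc F I x y.

Definition separatrix (F : S -> set S) (p : S) (C : set S) : Prop :=
  exists x, (F p `\ p) x /\ C = path_component (F p `\ p) x.

End Arcs.

(** * Pairs of transverse measured singular foliations *)

Section Foliations.
Variables (R : realType) (S : topologicalType).
Implicit Types (Fs Fu : S -> set S) (mus muu : set S -> R).

Definition half_box (a : R) : set (R * R) :=
  [set u | (- a < u.1 < a) /\ (0 <= u.2 < a)].
Definition closed_half_box (a : R) : set (R * R) :=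
  [set u | (- a <= u.1 <= a) /\ (0 <= u.2 <= a)].

(** The model of a [k]-prong singularity is obtained from [k] half planes
    [{y >= 0}], cyclically indexed, by gluing [(- t, 0)] in the [j]-th one to
    [(t, 0)] in the next one, for [t >= 0].  The horizontal (stable) and
    vertical (unstable) foliations of the half planes match up.  For [k = 2]
    this is the plane with its horizontal and vertical lines; for [k = 1] it is
    a spine.  It is the singular foliation pair of [z^(k-2) dz^2]. *)
Definition glued (k : nat) (i j : 'I_k) (u v : R * R) : Prop :=
  [/\ j = ordS i, u.2 = 0, v.2 = 0, 0 <= v.1 & u.1 = - v.1].

Definition same_point (k : nat) (i j : 'I_k) (u v : R * R) : Prop :=
  [\/ i = j /\ u = v, u = (0, 0) /\ v = (0, 0),
      glued i j u v | glued j i v u].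

Definition same_horizontal (k : nat) (i j : 'I_k) (u v : R * R) : Prop :=
  (i = j /\ u.2 = v.2) \/ (u.2 = 0 /\ v.2 = 0).

Definition same_vertical (k : nat) (i j : 'I_k) (u v : R * R) : Prop :=
  [\/ i = j /\ u.1 = v.1, u.1 = 0 /\ v.1 = 0,
      [/\ j = ordS i, 0 < v.1 & u.1 = - v.1] |
      [/\ i = ordS j, 0 < u.1 & v.1 = - u.1]].

(** As [closed_half_box a] is compact, [S] is Hausdorff and [U] is open, the
    first four clauses make [U] homeomorphic to the open [k]-prong model. *)
Definition prong_chart Fs Fu (k : nat) (p : S) (a : R)
    (phi : 'I_k -> R * R -> S) : Prop :=
  let U := \bigcup_j (phi j @` half_box a) in
  [/\ (0 < k)%N /\ 0 < a,
      forall j, {within closed_half_box a, continuous (phi j)} /\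
                phi j (0, 0) = p,
      forall i j u v, closed_half_box a u -> closed_half_box a v ->
        (phi i u = phi j v <-> same_point i j u v),
      open U &
      forall i j u v, half_box a u -> half_box a v ->
        (path_component R (Fs (phi i u) `&` U) (phi i u) (phi j v)
           <-> same_horizontal i j u v) /\
        (path_component R (Fu (phi i u) `&` U) (phi i u) (phi j v)
           <-> same_vertical i j u v)].

(** The transverse measures are [|dy|] and [|dx|] in the chart.  The side
    condition for [y = 0] keeps the segment inside one prong: at a spine, the
    boundary of the half plane is folded onto the prong. *)
Definition normalized_chart Fs Fu mus muu (k : nat) (p : S) (a : R)
    (phi : 'I_k -> R * R -> S) : Prop :=
  [/\ prong_chart Fs Fu p a phi,
      forall j x c d, - a < x < a -> 0 <= c -> c < d -> d < a ->
        mus (phi j @` [set u | u.1 = x /\ (c <= u.2 <= d)]) = d - c &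
      forall j y c d, 0 <= y < a -> - a < c -> c < d -> d < a ->
        (y = 0 -> 0 <= c \/ d <= 0) ->
        muu (phi j @` [set u | u.2 = y /\ (c <= u.1 <= d)]) = d - c].

Definition additive_on (F : S -> set S) (m : set S -> R) : Prop :=
  forall I J x y z, leaf_arc R F I x y -> leaf_arc R F J y z ->
    I `&` J = [set y] -> m (I `|` J) = m I + m J.

Definition foliation (F : S -> set S) : Prop :=
  [/\ forall x, F x x,
      forall x y, F x y -> F y = F x &
      forall x y, F x y -> path_component R (F x) x y].

(** The measure [mus] transverse to [Fs] is recorded by the lengths it gives to
    the unstable intervals, and [muu] by the lengths of the stable intervals;
    values on other sets are irrelevant.  Invariance under holonomy is contained
    in the existence of normalized charts. *)
Definition transverse_measured_foliations Fs Fu mus muu : Prop :=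
  [/\ foliation Fs, foliation Fu, additive_on Fu mus, additive_on Fs muu &
      forall p, exists k a phi, @normalized_chart Fs Fu mus muu k p a phi].

Definition singularities Fs Fu : set S :=
  [set p | ~ exists a phi, @prong_chart Fs Fu 2 p a phi].

Definition generalized_pseudo_anosov (A : set (chart R S)) (f : S -> S)
    Fs Fu mus muu (lambda : R) : Prop :=
  [/\ homeo f /\ orientation_preserving A f,
      transverse_measured_foliations Fs Fu mus muu,
      1 < lambda,
      forall x, f @` Fs x = Fs (f x) /\ f @` Fu x = Fu (f x) &
      (forall J, interval_of R Fu J -> mus (f @` J) = lambda * mus J) /\
      (forall I, interval_of R Fs I -> muu (f @` I) = lambda^-1 * muu I)].

Definition is_Sing (f : S -> S) Fs Fu (Sg : set S) : Prop :=
  (singularities Fs Fu !=set0 -> Sg = singularities Fs Fu) /\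
  (singularities Fs Fu = set0 ->
    [/\ Sg !=set0, finite_set Sg, f @` Sg = Sg &
        forall p, Sg p -> exists2 m, (0 < m)%N & iter m f p = p]).

End Foliations.

(** * Rectangles *)

Section Rectangles.
Variables (R : realType) (S : topologicalType) (A : set (chart R S)).
Variables (Fs Fu : S -> set S).

(** A rectangle is the closure of a trivially bi-foliated set [r].  It is
    represented by [r], its interior, since the closure alone need not
    determine [r]. *)
Definition trivially_bifoliated (r : set S) : Prop :=
  let I x := closure (path_component R (Fs x `&` r) x) in
  let J x := closure (path_component R (Fu x `&` r) x) in
  [/\ open r, connected r, r !=set0 &
      forall x y, r x -> r y ->
        [/\ exists a b, is_arc R (I x) a b, exists a b, is_arc R (J y) a b &
            exists2 w, r w & I x `&` J y = [set w]]].

Definition parametrization (r : set S) (rho : R * R -> S) : Prop :=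
  [/\ {within @closed_square R, continuous rho} /\
        rho @` @closed_square R = closure r,
      [/\ rho @` @open_square R = r, {in @open_square R &, injective rho} &
          forall O, open O -> O `<=` @open_square R -> open (rho @` O)],
      forall u c, open_square u -> A c -> cdom c (rho u) ->
        orientation_preserving_at (cmap c \o rho) u,
      forall t, 0 <= t <= 1 ->
        {in `[0, 1] &, injective (fun s => rho (s, t))} /\
        (forall s, 0 <= s <= 1 -> Fs (rho (0, t)) (rho (s, t))) &
      forall s, 0 <= s <= 1 ->
        {in `[0, 1] &, injective (fun t => rho (s, t))} /\
        (forall t, 0 <= t <= 1 -> Fu (rho (s, 0)) (rho (s, t)))].

Definition embedded_parametrization (rho : R * R -> S) : Prop :=
  exists r, [/\ trivially_bifoliated r, parametrization r rho &
                {in @closed_square R &, injective rho}].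

Definition subrectangle (F : S -> set S) (h r : set S) : Prop :=
  [/\ trivially_bifoliated h, closure h `<=` closure r &
      forall x, h x -> path_component R (F x `&` h) x
                       = path_component R (F x `&` r) x].
Definition horizontal_subrectangle := subrectangle Fs.
Definition vertical_subrectangle := subrectangle Fu.

(** The vertical and horizontal directions are the images under [gr_par] of the
    constant directions [gr_v] and [gr_h] of the square. *)
Record geo_rect := GeoRect {
  gr_int : set S;
  gr_par : R * R -> S;
  gr_v : R * R;
  gr_h : R * R }.

Definition is_geo_rect (G : geo_rect) : Prop :=
  [/\ trivially_bifoliated (gr_int G), parametrization (gr_int G) (gr_par G),
      gr_v G = (0, 1) \/ gr_v G = (0, -1),
      gr_h G = (1, 0) \/ gr_h G = (-1, 0) &
      0 < (gr_v G).1 * (gr_h G).2 - (gr_v G).2 * (gr_h G).1].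

Definition geo_markov_partition (f : S -> S) (N : nat) (G : 'I_N -> geo_rect)
    : Prop :=
  let r i := gr_int (G i) in
  [/\ forall i, is_geo_rect (G i),
      \bigcup_i closure (r i) = [set: S],
      forall i j, i != j -> r i `&` r j = set0,
      forall i j C, components (r i `&` f @^-1` r j) C ->
        horizontal_subrectangle C (r i) &
      forall i j C, components (f @` r i `&` r j) C ->
        vertical_subrectangle C (r j)].

(** ** Geometric types *)

Record geo_type := GeoType {
  gt_N : nat;
  gt_h : {ffun 'I_gt_N -> nat};
  gt_v : {ffun 'I_gt_N -> nat};
  gt_rho : {ffun {i : 'I_gt_N & 'I_(gt_h i)} -> {k : 'I_gt_N & 'I_(gt_v k)}};
  gt_eps : {ffun {i : 'I_gt_N & 'I_(gt_h i)} -> int} }.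

Definition enumerates (n : nat) (c : 'I_n -> set S) (C : set (set S)) : Prop :=
  injective c /\ range c = C.

(** The image of [C] lies before that of [D] along the direction [v]. *)
Definition precedes (rho : R * R -> S) (v : R * R) (C D : set S) : Prop :=
  forall u w, open_square u -> open_square w -> C (rho u) -> D (rho w) ->
    dot u v < dot w v.

Definition vertical_lt (G : geo_rect) (x y : S) : Prop :=
  exists u w, [/\ open_square u /\ open_square w, u.1 = w.1,
                  gr_par G u = x, gr_par G w = y & dot u (gr_v G) < dot w (gr_v G)].

(** [H i j] and [V k l] are the interiors of the [j]-th horizontal subrectangle
    of the [i]-th rectangle and of the [l]-th vertical subrectangle of the
    [k]-th rectangle. *)
Definition has_geo_type (f : S -> S) (T : geo_type)
    (G : 'I_(gt_N T) -> geo_rect) : Prop :=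
  let r i := gr_int (G i) in
  exists (H : forall i, 'I_(gt_h T i) -> set S)
         (V : forall k, 'I_(gt_v T k) -> set S),
  [/\ forall i, enumerates (H i) (components (r i `&` \bigcup_j (f @^-1` r j)))
        /\ forall j j' : 'I_(gt_h T i), (j < j')%N ->
             precedes (gr_par (G i)) (gr_v (G i)) (H i j) (H i j'),
      forall k, enumerates (V k) (components (r k `&` \bigcup_i (f @` r i)))
        /\ forall l l' : 'I_(gt_v T k), (l < l')%N ->
             precedes (gr_par (G k)) (gr_h (G k)) (V k l) (V k l'),
      forall i j k l,
        gt_rho T (existT _ i j) = existT _ k l <->
        f @` closure (H i j) = closure (V k l) &
      forall i j,
        let k := tag (gt_rho T (existT _ i j)) in
        let preserves := forall x y, H i j x -> H i j y ->
          vertical_lt (G i) x y -> vertical_lt (G k) (f x) (f y) in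
        (preserves /\ gt_eps T (existT _ i j) = 1) \/
        (~ preserves /\ gt_eps T (existT _ i j) = -1)].

(** * Rails and compatibility *)

Definition cup (d : set (set S)) : set S := \bigcup_(I in d) I.
Definition all_endpoints (d : set (set S)) : set S := \bigcup_(I in d) endpoints R I.
Definition regular_part (d : set (set S)) : set S := cup d `\` all_endpoints d.

Definition regular_rail (F : S -> set S) (d : set (set S)) (J : set S) : Prop :=
  [/\ interval_of R F J, arc_interior R J `&` cup d = set0 &
      endpoints R J `<=` regular_part d].

(** [P] is the set of embedded parametrizations whose second coordinate runs
    along [F]. *)
Definition extreme_rail (P : set (R * R -> S)) (F : S -> set S)
    (d : set (set S)) (J : set S) : Prop :=
  [/\ interval_of R F J,
      exists x, endpoints R J x /\ ~ regular_part d x &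
      exists rho e, [/\ P rho, e = 0 \/ e = 1,
        rho @` [set u | (0 <= u.1 <= 1) /\ (u.2 = 0 \/ u.2 = 1)] `<=` cup d,
        J = rho @` [set u | u.1 = e /\ (0 <= u.2 <= 1)] &
        forall s, 0 <= s <= 1 -> s != e ->
          regular_rail F d (rho @` [set u | u.1 = s /\ (0 <= u.2 <= 1)])]].

Definition extreme_u_rail :=
  extreme_rail [set rho | embedded_parametrization rho] Fu.
Definition extreme_s_rail :=
  extreme_rail [set rho | embedded_parametrization (fun u => rho (u.2, u.1))] Fs.

Definition compatible (ds du : set (set S)) : Prop :=
  [/\ all_endpoints ds `<=` cup du, all_endpoints du `<=` cup ds,
      forall J, extreme_u_rail ds J -> J `<=` cup du &
      forall J, extreme_s_rail du J -> J `<=` cup ds].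

(** * Primitive Markov partitions *)

Variables (f : S -> S) (Sg : set S).

Definition first_intersection (x : S) : Prop :=
  ~ Sg x /\
  exists p q Cs Cu I J,
    [/\ Sg p /\ Sg q, separatrix R Fs p Cs /\ separatrix R Fu q Cu,
        Cs x /\ Cu x, leaf_arc R Fs I p x /\ leaf_arc R Fu J q x &
        (I `\ p) `&` (J `\ q) = [set x]].

(** The arc [[q, z]^u]: no unstable leaf contains two points of [Sg] or a closed
    curve, so the union below has only one term. *)
Definition Ju (z : S) : set S :=
  \bigcup_(J in [set J | exists2 q, Sg q & leaf_arc R Fu J q z]) J.

Definition calJu (z : S) : set S := \bigcup_i (iter i f @^-1` Ju z).

Definition segments_to (F : S -> set S) (B : set S) : set (set S) :=
  [set I | exists p x, [/\ Sg p, B x, leaf_arc R F I p x &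
                           (I `\` [set p; x]) `&` B = set0]].

Definition delta_s (z : S) := segments_to Fs (calJu z).
Definition delta_u (z : S) := segments_to Fu (cup (delta_s z)).
Definition delta_u_iter (n : nat) (z : S) : set (set S) :=
  [set iter n f @` I | I in delta_u z].

Definition compatible_from (z : S) (m : nat) : Prop :=
  forall n, (m <= n)%N -> compatible (delta_s z) (delta_u_iter n z).

Definition compatibility_coefficient (z : S) (m : nat) : Prop :=
  compatible_from z m /\ forall m', compatible_from z m' -> (m <= m')%N.

Definition compatibility_order (nf : nat) : Prop :=
  let coefs := [set m | exists2 z, first_intersection z
                                 & compatibility_coefficient z m] in
  coefs nf /\ forall m, coefs m -> (m <= nf)%N.

(** [G] is [R(z, n)] with some labeling and some choice of directions. *)
Definition primitive_partition (z : S) (n : nat) (N : nat)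
    (G : 'I_N -> geo_rect) : Prop :=
  geo_markov_partition f G /\
  enumerates (fun i => gr_int (G i))
    (components (~` (cup (delta_s z) `|` cup (delta_u_iter n z)))).

Definition primitive_types (n : nat) : set geo_type :=
  [set T | exists z (G : 'I_(gt_N T) -> geo_rect),
    [/\ first_intersection z, primitive_partition z n G & has_geo_type f G]].

End Rectangles.

(* Main.v *)
Require Import Defs.
From mathcomp Require Import all_boot all_order all_algebra.
From mathcomp Require Import all_classical all_reals all_analysis.
From mathcomp Require Import zify lra.

(** The number of rectangles and of horizontal and vertical subrectangles of
    [R(z, n)] are numbers of connected components of sets built from
    [delta_s z], [delta_u z] and [f]; they do not change when [z] is replaced by
    [f z], and they bound the geometric type. So it suffices to show that the
    first intersection points lie in finitely many [f]-orbits.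

    [Sing] is finite, since every point of a prong chart other than its center
    is regular, and the arcs issued from [Sing] have finitely many initial
    prongs. No such arc joins two points of [Sing]: its iterates would have
    lengths tending to [0]. Hence two arcs with the same initial prong are
    nested. Let [x0] and [x] be first intersection points of the separatrices of
    [p] and [q] with the same prongs, and let [h] be a power of [f] fixing [p],
    [q] and these prongs. After replacing [x] by a point of its orbit,
    [[p, h x0]^s] is contained in [[p, x]^s], which is contained in
    [[p, x0]^s]. Then [[q, x]^u] is contained in [[q, h x0]^u], for otherwise
    [h x0] would be a point of [[p, x]^s] and [[q, x]^u] other than [x]. So [x]
    is one of the finitely many intersection points of the fixed compact arcs
    [[p, x0]^s] and [[q, h x0]^u]. *)

Set Implicit Arguments.
Unset Strict Implicit.
Unset Printing Implicit Defensive.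

Import Order.TTheory GRing.Theory Num.Theory.
Import numFieldNormedType.Exports.

Local Open Scope classical_set_scope.
Local Open Scope ring_scope.

(** * Segments and arcs *)

Section Segments.
Variable R : realType.
Implicit Types (a b c d s t : R).

(** What has to be excluded is branching. Leaves are usually dense, so that an arc is controlled
    only through its parametrization and through the charts that it crosses. Two arcs with the same
    initial prong can separate only where one of them ends or at a point that does not have exactly
    two prongs; the absence of arcs between points of [Sing] keeps such points out of the interior
    of the arcs in question. The transverse measure serves as arc length. It is strictly monotone on
    nested arcs, hence decides which of two nested arcs is the smaller one, and it selects the power
    of [h] in the normalisation. Only stable arcs are normalised by length; the position of the
    unstable arc then follows from the definition of a first intersection. Unstable arcs are
    classified by their prongs in the same way, with the inverse of [f] as the contraction. Counting
    is enough at the end: once the numbers of rectangles and subrectangles are bounded, [rho] and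
    [eps] range over finite sets, so no labeling or direction of one partition has to be matched
    with those of another. *)

Definition seg a b : set R := [set t | a <= t <= b].

Lemma segE a b : seg a b = `[a, b]%classic.
Proof. by rewrite set_itvE. Qed.

Lemma seg_compact a b : compact (seg a b).
Proof. rewrite segE; exact: segment_compact. Qed.

(** Connectedness of a segment, in the form that replaces the intermediate value theorem for maps
    into [S], where there is no order. *)
Lemma seg_meets_closed a b (A B : set R) : closed A -> closed B -> a <= b ->
  seg a b `<=` A `|` B -> A a -> B b -> exists2 x, seg a b x & A x /\ B x.
Proof.
move=> cA cB ab AB Aa Bb; apply: contrapT => nAB.
have conn : connected (seg a b) by rewrite segE; exact: segment_connected.
have eqA : seg a b `&` A = seg a b.
  apply: (conn (seg a b `&` A)).
  - by exists a; split => //; rewrite /seg /= lexx.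
  - exists (~` B); first exact: closed_openC.
    apply/seteqP; split=> x [xs xA]; split=> //.
      by move=> xB; apply: nAB; exists x.
    by case: (AB _ xs).
  - by exists A.
apply: nAB; exists b; first by rewrite /seg /= ab lexx.
split=> //; have : seg a b b by rewrite /seg /= ab lexx.
by rewrite -eqA => -[].
Qed.

(** Retraction of the line onto a segment. Composition with it makes every arc continuous on the
    whole line, which removes subspace topologies from the later arguments. *)
Definition clamp a b t := Num.max a (Num.min b t).

Lemma clamp_continuous a b : continuous (clamp a b).
Proof.
move=> t; apply: continuous_max; first exact: cst_continuous.
by apply: continuous_min; [exact: cst_continuous | exact: id].
Qed.

Lemma clamp_seg a b t : a <= b -> seg a b (clamp a b t).
Proof.
by move=> ab; rewrite /seg/clamp /= le_max lexx /= ge_max ab ge_min lexx.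
Qed.

Lemma clampE a b t : seg a b t -> clamp a b t = t.
Proof.
by move=> /andP[at_ tb]; rewrite /clamp; move/min_idPr: tb => ->; apply/max_idPr.
Qed.

Definition inj_seg (T : Type) (g : R -> T) a b :=
  forall s t, seg a b s -> seg a b t -> g s = g t -> s = t.

End Segments.

Lemma within_comp (T U V : topologicalType) (A : set U) (g : U -> V)
    (c : T -> U) :
  {within A, continuous g} -> continuous c -> (forall t, A (c t)) ->
  continuous (g \o c).
Proof.
move=> /subspace_continuousP gc cc Ac t.
apply: cvg_trans (gc _ (Ac t)).
move=> P /= /(cc t); rewrite /= !nbhs_simpl /=.
by apply: filterS => s; apply; exact: Ac.
Qed.

(* [lra] fails when the context has equations in a topological space. *)
Ltac seglra :=
  rewrite ?/seg /=;
  repeat match goal with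
  | H : @eq (Topological.sort ?X) _ _ |- _ => is_var X; clear H
  end; try lra.

Section Arcs.
Variables (R : realType) (S : topologicalType).
Hypothesis hausS : hausdorff_space S.
Implicit Types (a b c d s t : R) (g h : R -> S).

Lemma image_seg_closed g a b : continuous g -> closed (g @` seg a b).
Proof.
move=> gc; apply: compact_closed hausS _.
apply: continuous_compact (@seg_compact R a b).
exact: continuous_subspaceT.
Qed.

Lemma preim_closed g (A : set S) : continuous g -> closed A -> closed (g @^-1` A).
Proof. by move=> gc; apply: preimage_closed => x _; exact: gc. Qed.

Lemma clamp_arc g a b : a <= b -> {within `[a, b], continuous g} ->
  continuous (g \o clamp a b).
Proof.
move=> ab gc; apply: within_comp gc (@clamp_continuous R a b) _ => t.
by rewrite -segE; exact: clamp_seg.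
Qed.

Lemma is_arcP (I : set S) x y : is_arc R I x y <->
  exists g, [/\ continuous g, inj_seg g 0 1, I = g @` seg 0 1, g 0 = x & g 1 = y].
Proof.
split.
- move=> [g [gc gi -> <- <-]]; exists (g \o clamp 0 1).
  have s0 : seg (0:R) 1 0 by rewrite /seg /= lexx ler01.
  have s1 : seg (0:R) 1 1 by rewrite /seg /= lexx ler01.
  split.
  + exact: clamp_arc.
  + move=> s t hs ht /=; rewrite !clampE //.
    by apply: gi; rewrite ?inE ?in_itv.
  + rewrite -segE; apply/seteqP; split=> _ [t tI <-]; exists t => //=;
    by rewrite clampE.
  + by rewrite /= clampE.
  + by rewrite /= clampE.
- move=> [g [gc gi -> <- <-]]; exists g; split=> //.
  + exact: continuous_subspaceT.
Qed.

Lemma is_arc_seg g a b : continuous g -> inj_seg g a b -> a < b ->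
  is_arc R (g @` seg a b) (g a) (g b).
Proof.
move=> gc gi ab; apply/is_arcP; exists (fun t => g (a + t * (b - a))).
have ba : 0 < b - a by rewrite subr_gt0.
split.
- move=> t; apply: (@continuous_comp _ _ _ (fun t => a + t * (b - a)) g).
    apply: cvgD; first exact: cvg_cst.
    by apply: cvgM; [exact: cvg_id | exact: cvg_cst].
  exact: gc.
- move=> s t /andP[s0 s1] /andP[t0 t1] /gi e.
  have : a + s * (b - a) = a + t * (b - a).
    by apply: e; rewrite /seg /=; nra.
  by move/addrI/mulIf; apply; rewrite gt_eqF.
- apply/seteqP; split=> _ [t /andP[h1 h2] <-].
    exists ((t - a) / (b - a)).
      rewrite /seg /= divr_ge0 ?ler_pdivrMr //; lra.
    by rewrite divfK ?gt_eqF // addrC subrK.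
  by exists (a + t * (b - a)) => //; rewrite /seg /=; nra.
- by rewrite mul0r addr0.
- by rewrite mul1r addrC subrK.
Qed.

(** The preimages under [g] of the two halves of the arc [h] cut at [s] are closed and cover the
    segment, so they meet; injectivity of [h] forces the common point to be [h s]. *)
Lemma arc_ivt g h a b c d s1 s2 : continuous g -> continuous h ->
  inj_seg h a b -> c <= d -> g @` seg c d `<=` h @` seg a b ->
  a <= s1 -> s1 <= s2 -> s2 <= b -> g c = h s1 -> g d = h s2 ->
  h @` seg s1 s2 `<=` g @` seg c d.
Proof.
move=> gc hc hi cd sub as1 s12 s2b gcE gdE _ [s /andP[s1s ss2] <-].
have [x xs [[u ug xu] [v vg xv]]] :
    exists2 x, seg c d x & (g @^-1` (h @` seg a s)) x /\ (g @^-1` (h @` seg s b)) x.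
  apply: seg_meets_closed => //.
  - by apply: preim_closed => //; apply: image_seg_closed.
  - by apply: preim_closed => //; apply: image_seg_closed.
  - move=> x /(imageP g) /sub [u /andP[au ub] hu].
    case: (leP u s) => us; [left | right]; exists u => //; seglra.
  - by exists s1 => //; rewrite /seg /= as1.
  - by exists s2 => //; rewrite /seg /= ss2.
exists x => //; rewrite -xu; congr h.
have uv : u = v.
  by apply: hi; [move: ug; seglra | move: vg; seglra | rewrite xu xv].
move: ug vg; rewrite -uv; seglra.
Qed.

(** If [g] reached a point of [h] beyond [s2] at a time [t], then by [arc_ivt] it would have passed
    through [h s2 = g d] by that time; injectivity of [g] leaves only [t = d]. *)
Lemma arc_sub_eq g h a b c d s2 : continuous g -> continuous h ->
  inj_seg h a b -> inj_seg g c d -> c <= d -> g @` seg c d `<=` h @` seg a b ->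
  a <= s2 -> s2 <= b -> g c = h a -> g d = h s2 ->
  g @` seg c d = h @` seg a s2.
Proof.
move=> gc hc hi gi cd sub as2 s2b gcE gdE; apply/seteqP; split; last first.
  exact: arc_ivt hi cd sub (lexx a) _ _ _ _.
move=> _ [t tcd <-]; have [s sab hs] := sub _ (imageP g tcd).
case: (leP s s2) => ss2.
  by exists s => //; move: sab ss2; seglra.
have tcd' := tcd; move: tcd' => /andP[ct td].
have sub' : g @` seg c t `<=` h @` seg a b.
  move=> _ [u uct <-]; apply: sub; exists u => //.
  by move: uct; seglra.
have := @arc_ivt g h a b c t a s gc hc hi ct sub' (lexx a).
have [h1 h2] : a <= s /\ s <= b by move/andP: sab.
move=> /(_ h1 h2 gcE (esym hs)) /(_ (h s2)) [].
  by exists s2 => //; rewrite /seg /= as2 ltW.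
move=> u uct; rewrite -gdE => /gi ud.
have {}ud : u = d by apply: ud; move: uct cd td; seglra.
have td' : t = d by apply/eqP; rewrite eq_le td /=; move: uct; rewrite ud => /andP[].
by rewrite td' in hs *; exists s2; rewrite /seg /= ?as2 ?lexx.
Qed.

End Arcs.

(** * Prongs of a leaf *)

Section Stars.
Variables (R : realType) (S : topologicalType).
Hypothesis hausS : hausdorff_space S.
Implicit Types (a b c d s t : R) (g h : R -> S) (L : set S).

(** The local shape of a leaf [L] at [w]: [k] prongs [pr j], which near [w]
    contain every path of [L] starting at [w]. *)
Definition star L w (k : nat) a (pr : 'I_k -> R -> S) : Prop :=
  [/\ 0 < a,
      forall j, continuous (pr j) /\ pr j 0 = w,
      forall i j s t, seg 0 a s -> seg 0 a t -> pr i s = pr j t ->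
        (i = j /\ s = t) \/ (s = 0 /\ t = 0),
      forall j t, 0 <= t -> t < a -> L (pr j t) &
      forall g, continuous g -> g 0 = w -> (forall t, L (g t)) ->
        exists2 e, 0 < e &
          forall t, seg 0 e t -> exists j s, [/\ 0 <= s, s < a & g t = pr j s]].

Lemma star_inj L w k a (pr : 'I_k -> R -> S) j : star L w a pr ->
  inj_seg (pr j) 0 a.
Proof. by move=> [_ _ pi _ _] s t hs ht /pi[] // [] // -> ->. Qed.

(** Near [w] every point of the arc lies on some prong. Prongs are closed and meet only in [w], to
    which an injective arc does not return, so by connectedness the arc stays on one prong and runs
    along it from the beginning. *)
Lemma star_germ L w k a (pr : 'I_k -> R -> S) g c d : star L w a pr ->
  continuous g -> c < d -> inj_seg g c d -> g c = w ->
  (forall t, seg c d t -> L (g t)) ->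
  exists j e, [/\ c < e, e <= d &
    forall y, c < y -> y <= e -> exists t,
      [/\ 0 < t, t < a, g y = pr j t & g @` seg c y = pr j @` seg 0 t]].
Proof.
move=> st gc cd gi gw gL; have [a0 pc pi pL pcap] := st.
have cdc t : seg c d (clamp c d (c + t)) by apply: clamp_seg; exact: ltW.
have [|||e0 e0p cap] := pcap (fun t => g (clamp c d (c + t))).
- move=> t.
  apply: (@continuous_comp _ _ _ (fun t => clamp c d (c + t)) g); last exact: gc.
  apply: (@continuous_comp _ _ _ (fun t => c + t) (clamp c d)).
    by apply: cvgD; [exact: cvg_cst | exact: cvg_id].
  exact: clamp_continuous.
- by rewrite /= addr0 clampE //; rewrite /seg /= lexx ltW.
- by move=> t; exact: gL.
pose e := Num.min (c + e0) d.
have ce : c < e by rewrite lt_min cd ltrDl e0p.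
have ed : e <= d by rewrite ge_min lexx orbT.
have ee0 : e <= c + e0 by rewrite ge_min lexx.
have {}cap t : seg c e t -> exists j s, [/\ 0 <= s, s < a & g t = pr j s].
  move=> ht; have [|j [s]] := cap (t - c); first by move: ht; seglra.
  rewrite addrC subrK clampE; last by move: ht; seglra.
  by move=> ?; exists j, s.
have inw t : seg c e t -> g t = w -> t = c.
  by move=> ht; rewrite -gw => /gi; apply; move: ht; seglra.
have [j [s [s0 sa ges]]] : exists j s, [/\ 0 <= s, s < a & g e = pr j s].
  by apply: cap; rewrite /seg /= lexx ltW.
have capj t : c < t -> t <= e -> exists s, [/\ 0 < s, s < a & g t = pr j s].
  move=> ct te; have [|i [u [u0 ua gtu]]] := cap t; first by seglra.
  have u_gt0 : 0 < u.
    rewrite lt_neqAle u0 andbT; apply/eqP => uE; move: gtu.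
    rewrite -uE (pc i).2 => /inw tc.
    have {}tc : t = c by apply: tc; seglra.
    by move: ct; rewrite tc ltxx.
  case: (eqVneq i j) => [<-|ij]; first by exists u.
  (* Prong [j] and the union of the others are closed and cover the arc between [t] and [e], so they
     share a point of it. That point is [w], which the arc visits only at time [c < t]. *)
  exfalso.
  have [||||||x xs [[i' /= ij' [u1 u1s u1E]] [v1 v1s v1E]]] := @seg_meets_closed R t e
    (g @^-1` (\bigcup_(i in [set i | i != j]) (pr i @` seg 0 a)))
    (g @^-1` (pr j @` seg 0 a)).
  - apply: preim_closed => //; apply: closed_bigcup; first exact: finite_finset.
    by move=> i' _; apply: image_seg_closed => //; case: (pc i').
  - by apply: preim_closed => //; apply: image_seg_closed => //; case: (pc j).
  - exact: te.
  - move=> y yt; have [|i' [s' [s'0 s'a gys']]] := cap y; first by move: yt; seglra.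
    case: (eqVneq i' j) => [<-|ij']; [right|left; exists i' => //]; exists s' => //; seglra.
  - by exists i => //; exists u => //; seglra.
  - by exists s => //; seglra.
  have [[ijE _]|[_ v10]] := pi i' j u1 v1 u1s v1s (etrans u1E (esym v1E)).
    by rewrite ijE eqxx in ij'.
  move: v1E; rewrite v10 (pc j).2 => /esym/inw xc.
  have {}xc : x = c by apply: xc; move: xs; seglra.
  by move: xs; rewrite xc; seglra.
exists j, e; split=> // y cy ye; have [u [u0 ua gyu]] := capj y cy ye.
exists u; split=> //.
apply: (@arc_sub_eq R S hausS g (pr j) 0 a) => //.
- by case: (pc j).
- exact: star_inj st.
- by move=> p q hp hq; apply: gi; [move: hp|move: hq]; seglra.
- exact: ltW.
- move=> _ [t ts <-]; case: (ltP c t) => ct.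
    have [|v [v0 va ->]] := capj t ct; first by move: ts; seglra.
    by exists v => //; seglra.
  have -> : t = c by move: ts; seglra.
  by exists 0; rewrite ?gw ?(pc j).2 //; seglra.
- exact: ltW.
- exact: ltW.
- by rewrite gw (pc j).2.
Qed.

(** The germ indexed by the parameter of the prong instead of that of the arc, so that two arcs on
    one prong can be compared at the same [u]. *)
Lemma star_germ_seg L w k a (pr : 'I_k -> R -> S) g c d : star L w a pr ->
  continuous g -> c < d -> inj_seg g c d -> g c = w ->
  (forall t, seg c d t -> L (g t)) ->
  exists j t, [/\ 0 < t, t < a & forall u, 0 < u -> u <= t ->
    exists e, [/\ c < e, e <= d, g e = pr j u & g @` seg c e = pr j @` seg 0 u]].
Proof.
move=> st gc cd gi gw gL; have [j [e [ce ed H]]] := star_germ st gc cd gi gw gL.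
have [t [t0 ta get gseg]] := H e ce (lexx e).
exists j, t; split=> // u u0 ut.
have [y ys yu] : (g @` seg c e) (pr j u).
  by rewrite gseg; exists u => //; seglra.
have cy : c < y.
  rewrite lt_neqAle; apply/andP; split; last by move: ys; seglra.
  apply/eqP => yE; move: yu; rewrite -yE gw -(_ : pr j 0 = w); last first.
    by case: st => _ pc _ _ _; case: (pc j).
  move/(star_inj st) => u0E; have : 0 = u by apply: u0E; seglra.
  by lra.
have [|t' [t'0 t'a gyt' gs]] := H y cy; first by move: ys; seglra.
have t'u : t' = u.
  by apply: (star_inj (j := j) st); rewrite -?gyt' ?yu //; seglra.
by exists y; rewrite -t'u -gyt' -gs; split=> //; move: ys; seglra.
Qed.

End Stars.

(** * Unique continuation of leaf arcs through points with two prongs *)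

Section UniqueContinuation.
Variables (R : realType) (S : topologicalType) (F : S -> set S).
Hypothesis hausS : hausdorff_space S.
Hypothesis Feq : forall x y, F x y -> F y = F x.
Implicit Types (a b c d s t : R) (g h : R -> S).

(* At a point with only two prongs, an arc that arrives along one of them has
   to leave along the other one. *)
Lemma unique_continuation g h :
  continuous g -> continuous h -> inj_seg g 0 1 -> inj_seg h 0 1 ->
  g 0 = h 0 -> (forall t, seg 0 1 t -> F (g 0) (g t)) ->
  (forall t, seg 0 1 t -> F (h 0) (h t)) ->
  (exists e : R, [/\ 0 < e, e <= 1 & g @` seg 0 e `<=` h @` seg 0 1]) ->
  (forall s, 0 < s -> s < 1 ->
     exists a (pr : 'I_2 -> R -> S), star (F (h s)) (h s) a pr) ->
  g @` seg 0 1 `<=` h @` seg 0 1 \/ h @` seg 0 1 `<=` g @` seg 0 1.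
Proof.
move=> gc hc gi hi gh0 gF hF [e0 [e00 e01 e0H]] reg.
pose H := h @` seg 0 1.
(* Times up to which [g] stays inside [h]. The goal is that at the supremum one of the two arcs has
   ended. *)
pose T : set R := [set t | seg 0 1 t /\ g @` seg 0 t `<=` H].
have Te0 : T e0 by split=> //; seglra.
have supT : has_sup T.
  split; first by exists e0.
  by exists 1 => t [/andP[]].
pose ts := sup T.
have e0ts : e0 <= ts by apply: ub_le_sup => //; case: supT.
have ts1 : ts <= 1 by apply: ge_sup; [exists e0|move=> t [/andP[]]].
have gtsH t : seg 0 ts t -> H (g t).
  move=> /andP[t0]; rewrite le_eqVlt => /orP[/eqP ->|tts].
    have cl : closed (g @^-1` H) by apply: preim_closed; [|exact: image_seg_closed].
    have TP : T `<=` g @^-1` H.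
      by move=> y [/andP[y0 y1] yH]; apply: yH; exists y => //; seglra.
    by apply: cl; apply: (closure_subset TP); apply: closure_sup; case: supT.
  have ts_t : 0 < ts - t by rewrite subr_gt0.
  have [u [us uH] tu] := sup_adherent ts_t supT.
  by apply: uH; exists t => //; move: tu; rewrite -/ts; seglra.
have segts : g @` seg 0 ts `<=` H by move=> _ [t tts <-]; exact: gtsH.
have [ss ss01 hss] : H (g ts) by apply: gtsH; seglra.
have [ss0 ss1] : 0 <= ss /\ ss <= 1 by case/andP: ss01.
have segE : g @` seg 0 ts = h @` seg 0 ss.
  apply: (arc_sub_eq hausS gc hc hi) => //; last lra.
  by move=> p q hp hq; apply: gi; [move: hp|move: hq]; seglra.
case: (eqVneq ts 1) => [ts1E|ts1N]; first by left; rewrite -{1}ts1E.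
case: (eqVneq ss 1) => [ss1E|ss1N].
  right; rewrite -{1}ss1E -segE => _ [t ht <-]; exists t => //.
  by move: ht; seglra.
have tslt : ts < 1 by rewrite lt_neqAle ts1N.
have sslt : ss < 1 by rewrite lt_neqAle ss1N.
have ssgt : 0 < ss.
  rewrite lt_neqAle ss0 andbT; apply/eqP => ssE; move: hss.
  rewrite -ssE -gh0 => /gi ts0; have {}ts0 : 0 = ts by apply: ts0; seglra.
  by seglra.
have [a [pr st]] := reg ss ssgt sslt.
have FE : F (h ss) = F (h 0) by apply: Feq; apply: hF; seglra.
have [j1 [t1 [t10 t1a G1]]] : exists j t, [/\ 0 < t, t < a & forall u, 0 < u -> u <= t ->
    exists e, [/\ ts < e, e <= 1, g e = pr j u & g @` seg ts e = pr j @` seg 0 u]].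
  apply: (star_germ_seg hausS st gc tslt) => //.
    by move=> p q hp hq; apply: gi; [move: hp|move: hq]; seglra.
  by move=> t ht; rewrite FE -gh0; apply: gF; move: ht; seglra.
have [j4 [t4 [t40 t4a G4]]] : exists j t, [/\ 0 < t, t < a & forall u, 0 < u -> u <= t ->
    exists e, [/\ ss < e, e <= 1, h e = pr j u & h @` seg ss e = pr j @` seg 0 u]].
  apply: (star_germ_seg hausS st hc sslt) => //.
    by move=> p q hp hq; apply: hi; [move: hp|move: hq]; seglra.
  by move=> t ht; rewrite FE; apply: hF; move: ht; seglra.
(* [j1] and [j4] are the prongs along which [g] and [h] leave the point; [j3], the prong along which
   [h] arrives, is the germ of [h] run backwards. *)
have [j3 [t3 [t30 t3a G3]]] : exists j t, [/\ 0 < t, t < a & forall u, 0 < u -> u <= t ->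
    exists e, [/\ 0 <= e, e < ss & h e = pr j u]].
  have := @star_germ_seg _ _ hausS _ _ _ _ pr (fun t => h (- t)) (- ss) 0 st.
  case=> //.
  - by move=> t; apply: continuous_comp; [exact: oppr_continuous|exact: hc].
  - by rewrite oppr_lt0.
  - move=> p q hp hq /hi pq; apply: oppr_inj; apply: pq.
      by move: hp; seglra.
    by move: hq; seglra.
  - by rewrite opprK.
  - by move=> t ht; rewrite FE; apply: hF; move: ht; seglra.
  move=> j [t [t0 ta K]]; exists j, t; split=> // u u0 ut.
  by have [e [se e0' hE _]] := K u u0 ut; exists (- e); split=> //; lra.
have minE (x y : R) : 0 < x -> 0 < y -> exists u, [/\ 0 < u, u <= x & u <= y].
  move=> x0 y0; exists (Num.min x y).
  by rewrite lt_min x0 y0 !ge_min !lexx orbT.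
(* Up to this point the two arcs have the same image, so if [g] left along [j3] it would pass again
   through its own past. *)
have j13 : j1 <> j3.
  move=> jE; have [u [u0 u1 u3]] := minE _ _ t10 t30.
  have [e [e1 e2 ge _]] := G1 u u0 u1; have [e' [e'0 e's he']] := G3 u u0 u3.
  have : (h @` seg 0 ss) (g e).
    by exists e'; [move: e's; seglra | rewrite ge jE].
  rewrite -segE => -[v hv] /gi vE; have {}vE : v = e.
    by apply: vE; move: hv; seglra.
  by move: hv; rewrite vE; seglra.
have j43 : j4 <> j3.
  move=> jE; have [u [u0 u1 u3]] := minE _ _ t40 t30.
  have [e [e1 e2 ge _]] := G4 u u0 u1; have [e' [e'0 e's he']] := G3 u u0 u3.
  have /hi ee' : h e = h e' by rewrite ge he' jE.
  have : e = e' by apply: ee'; seglra.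
  by seglra.
(* Both outgoing prongs differ from the incoming one and there are only two prongs; hence [g]
   follows [h] a little longer, against the choice of [ts]. *)
have j14 : j1 = j4.
  by apply/val_inj; move: j13 j43; case: j1 {G1} => -[|[|?]] //= ?;
    case: j4 {G4} => -[|[|?]] //= ?; case: j3 {G3} => -[|[|?]] //= ? A B;
    exfalso; (apply: A + apply: B); apply/val_inj.
have [u [u0 u1 u4]] := minE _ _ t10 t40.
have [e [e1 e2 _ gE]] := G1 u u0 u1; have [e' [e'0 e's _ hE]] := G4 u u0 u4.
have Te : T e.
  split; first by seglra.
  move=> _ [t ht <-]; case: (leP t ts) => tts.
    by apply: gtsH; move: ht; seglra.
  have : (g @` seg ts e) (g t) by exists t => //; move: ht; seglra.
  rewrite gE j14 -hE => -[v hv <-]; exists v => //; move: hv; seglra.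
have : e <= ts by apply: ub_le_sup => //; case: supT.
by seglra.
Qed.
End UniqueContinuation.

(** * Lengths of leaf arcs and saddle connections *)

Section LeafLengths.
Variables (R : realType) (S : topologicalType) (F : S -> set S) (m : set S -> R).
Hypothesis hausS : hausdorff_space S.
Hypothesis Ffol : foliation R F.
Hypothesis madd : additive_on F m.
Implicit Types (a b c d s t : R) (g h : R -> S) (I J : set S).

(** [F] stands for either foliation, and [m] for the measure transverse to the other one, which acts
    as arc length on the leaves of [F]; on the prongs it is the parameter. *)
Definition measured_star w (k : nat) a (pr : 'I_k -> R -> S) : Prop :=
  star (F w) w a pr /\ forall j c d, 0 <= c -> c < d -> d < a ->
    m (pr j @` seg c d) = d - c.

Variables (nprong : S -> nat) (radius : S -> R).
Variable prong : forall w, 'I_(nprong w) -> R -> S.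
Hypothesis starP : forall w, measured_star w (radius w) (@prong w).

Let Feq x y : F x y -> F y = F x. Proof. by case: Ffol => _ H _; exact: H. Qed.

Lemma leaf_arcP I x y : leaf_arc R F I x y <-> exists g,
  [/\ continuous g, inj_seg g 0 1, I = g @` seg 0 1, g 0 = x /\ g 1 = y &
      forall t, seg 0 1 t -> F x (g t)].
Proof.
split.
- move=> [/is_arcP[g [gc gi -> gx gy]] IF]; exists g; split=> // t ht.
  by apply: IF; exists t.
- move=> [g [gc gi -> [gx gy] gF]]; split; first by apply/is_arcP; exists g.
  by move=> _ [t ht <-]; exact: gF.
Qed.

Lemma leaf_arc_seg g a b : continuous g -> inj_seg g a b -> a < b ->
  (forall t, seg a b t -> F (g a) (g t)) ->
  leaf_arc R F (g @` seg a b) (g a) (g b).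
Proof.
move=> gc gi ab gF; split; first exact: is_arc_seg.
by move=> _ [t ht <-]; exact: gF.
Qed.

Lemma leaf_arc_mid g a b d : (forall t, seg a b t -> F (g a) (g t)) ->
  seg a b d -> forall t, seg a b t -> F (g d) (g t).
Proof. by move=> gF hd t ht; rewrite (Feq (gF _ hd)); exact: gF. Qed.

Lemma arc_len_add g a b c : continuous g -> inj_seg g a c -> a < b -> b < c ->
  (forall t, seg a c t -> F (g a) (g t)) ->
  m (g @` seg a c) = m (g @` seg a b) + m (g @` seg b c).
Proof.
move=> gc gi ab bc gF.
have -> : g @` seg a c = g @` seg a b `|` g @` seg b c.
  rewrite -image_setU; congr (_ @` _); apply/seteqP; split=> t.
    by move=> ht; case: (leP t b) => tb; [left|right]; move: ht; seglra.
  by case; seglra.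
apply: (@madd _ _ (g a) (g b) (g c)).
- apply: leaf_arc_seg => //.
    by move=> p q hp hq; apply: gi; [move: hp|move: hq]; seglra.
  by move=> t ht; apply: gF; move: ht; seglra.
- apply: leaf_arc_seg => //.
    by move=> p q hp hq; apply: gi; [move: hp|move: hq]; seglra.
  by move=> t ht; apply: (leaf_arc_mid gF); [|move: ht]; seglra.
- apply/seteqP; split=> [_ [[s hs <-] [t ht] /gi ts]|_ ->].
    have {}ts : t = s by apply: ts; [move: ht|move: hs]; seglra.
    by have -> : s = b by (move: ht hs; rewrite ts; seglra).
  by split; exists b => //; seglra.
Qed.

Lemma arc_len_pos_right g c d : continuous g -> c < d -> inj_seg g c d ->
  (forall t, seg c d t -> F (g c) (g t)) ->
  exists e, [/\ c < e, e <= d &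
    forall y, c < y -> y <= e -> 0 < m (g @` seg c y)].
Proof.
move=> gc cd gi gF; have [st mst] := starP (g c).
have [j [e [ce ed H]]] := star_germ hausS st gc cd gi erefl gF.
exists e; split=> // y cy ye; have [t [t0 ta _ ->]] := H y cy ye.
by rewrite mst // subr0.
Qed.

Lemma image_oppr g a b : (fun t => g (- t)) @` seg a b = g @` seg (- b) (- a).
Proof.
apply/seteqP; split=> _ [t ht <-]; first by exists (- t) => //; move: ht; seglra.
by exists (- t); rewrite ?opprK //; move: ht; seglra.
Qed.

Lemma arc_len_pos_left g c d : continuous g -> c < d -> inj_seg g c d ->
  (forall t, seg c d t -> F (g c) (g t)) ->
  exists e, [/\ c <= e, e < d &
    forall y, e <= y -> y < d -> 0 < m (g @` seg y d)].
Proof.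
move=> gc cd gi gF.
have [||||e [de ec H]] := @arc_len_pos_right (fun t => g (- t)) (- d) (- c).
- by move=> t; apply: continuous_comp; [exact: oppr_continuous|exact: gc].
- by lra.
- move=> p q hp hq /gi pq; apply: oppr_inj; apply: pq.
    by move: hp; seglra.
  by move: hq; seglra.
- by move=> t ht; rewrite opprK; apply: (leaf_arc_mid gF); [|move: ht]; seglra.
exists (- e); split; [lra|lra|] => y ey yd.
have := H (- y); rewrite image_oppr !opprK; apply; lra.
Qed.

(** Lengths are known explicitly only on prongs. Stars give positivity on short arcs on either side
    of each point, and additivity spreads it along the arc by a supremum argument. *)
Lemma arc_len_pos g a b : continuous g -> a < b -> inj_seg g a b ->
  (forall t, seg a b t -> F (g a) (g t)) -> 0 < m (g @` seg a b).
Proof.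
move=> gc ab gi gF.
pose T : set R := [set x | [/\ a < x, x <= b &
  forall y, a < y -> y <= x -> 0 < m (g @` seg a y)]].
have [e [ae eb He]] := arc_len_pos_right gc ab gi gF.
have Te : T e by split.
have supT : has_sup T by split; [exists e|exists b => x []].
have ets : e <= sup T by apply: ub_le_sup => //; case: supT.
have tsb : sup T <= b by apply: ge_sup; [exists e|move=> x []].
have below y : a < y -> y < sup T -> 0 < m (g @` seg a y).
  move=> ay; rewrite -subr_gt0 => /sup_adherent/(_ supT)[x [ax xb Hx]].
  by rewrite opprB addrC subrK => yx; apply: Hx => //; exact: ltW.
have aT : a < sup T by lra.
(* Cut at some [y] just before the supremum: the part up to [y] is positive by the definition of
   [T], the rest by the left germ. The midpoint keeps [y] to the right of [a]. *)
have TsupT : 0 < m (g @` seg a (sup T)).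
  have [||||e' [ae' eT H]] := @arc_len_pos_left g a (sup T) => //.
  - by move=> p q hp hq; apply: gi; [move: hp|move: hq]; seglra.
  - by move=> t ht; apply: gF; move: ht; seglra.
  pose y := Num.max e' ((a + sup T) / 2).
  have [ey my] : e' <= y /\ (a + sup T) / 2 <= y.
    by rewrite !le_max !lexx orbT.
  have yT : y < sup T by rewrite gt_max; apply/andP; split; lra.
  have ay : a < y by lra.
  rewrite (@arc_len_add g a y (sup T)) //; first last.
  - by move=> t ht; apply: gF; move: ht; seglra.
  - by move=> p q hp hq; apply: gi; [move: hp|move: hq]; seglra.
  by rewrite addr_gt0 //; [apply: below|apply: H].
case: (eqVneq (sup T) b) => [<- //|Tb].
have {}Tb : sup T < b by rewrite lt_neqAle Tb.
have [||||e2 [Te2 e2b H]] := @arc_len_pos_right g (sup T) b => //.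
- by move=> p q hp hq; apply: gi; [move: hp|move: hq]; seglra.
- by move=> t ht; apply: (leaf_arc_mid gF); [|move: ht]; seglra.
have : T e2.
  split; [lra|lra|] => y ay ye.
  case: (ltrgtP y (sup T)) => [yT|yT|->//]; first exact: below.
  rewrite (@arc_len_add g a (sup T) y) //; first last.
  - by move=> t ht; apply: gF; move: ht; seglra.
  - by move=> p q hp hq; apply: gi; [move: hp|move: hq]; seglra.
  by rewrite addr_gt0 // H.
move/ub_le_sup => /(_ _) e2T; have : e2 <= sup T by apply: e2T; case: supT.
by lra.
Qed.

Lemma leaf_arc_len_gt0 I x y : leaf_arc R F I x y -> 0 < m I.
Proof.
move=> /leaf_arcP[g [gc gi -> [gx gy] gF]].
by apply: arc_len_pos => //; rewrite gx.
Qed.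

(** The smaller arc is an initial piece of the larger one, and what is left over is empty or has
    positive length. This is what turns length comparisons into inclusions. *)
Lemma leaf_arc_len_sub I J x y z : leaf_arc R F I x y -> leaf_arc R F J x z ->
  I `<=` J -> I = J \/ m I < m J.
Proof.
move=> /leaf_arcP[g [gc gi -> [gx gy] gF]] /leaf_arcP[h [hc hi -> [hx hz] hF]] IJ.
have [s s01 hs] : (h @` seg 0 1) (g 1) by apply: IJ; exists 1 => //; seglra.
have [s0 s1] : 0 <= s /\ s <= 1 by case/andP: s01.
have -> : g @` seg 0 1 = h @` seg 0 s.
  by apply: (arc_sub_eq hausS gc hc hi gi) => //; rewrite gx hx.
have s_gt0 : 0 < s.
  rewrite lt_neqAle s0 andbT; apply/eqP => sE; move: hs.
  rewrite -sE hx -gx => /gi ts0; have {}ts0 : (0 : R) = 1 by apply: ts0; seglra.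
  by seglra.
case: (eqVneq s 1) => [->|sN1]; first by left.
have {}sN1 : s < 1 by rewrite lt_neqAle sN1.
right; rewrite [ltRHS](@arc_len_add h 0 s 1) //; last by rewrite hx.
rewrite ltrDl; apply: arc_len_pos => //.
  by move=> p q hp hq; apply: hi; [move: hp|move: hq]; seglra.
move=> t ht; apply: (@leaf_arc_mid _ 0 1); first by rewrite hx.
  by seglra.
by move: ht; seglra.
Qed.

Definition germ p (j : 'I_(nprong p)) I :=
  exists t, [/\ 0 < t, t < radius p & prong j @` seg 0 t `<=` I].

Lemma germ_ex I p x : leaf_arc R F I p x -> exists j, @germ p j I.
Proof.
move=> /leaf_arcP[g [gc gi -> [gx gy] gF]]; have [st _] := starP p.
have [j [e [e0 e1 H]]] := star_germ hausS st gc ltr01 gi gx gF.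
have [t [t0 ta _ ge]] := H e e0 (lexx e).
exists j, t; split=> //; rewrite -ge => _ [u hu <-]; exists u => //.
by move: hu; seglra.
Qed.

Lemma prong0 p (j : 'I_(nprong p)) : prong j 0 = p.
Proof. by have [[_ pc _ _ _] _] := starP p; case: (pc j). Qed.

Lemma prong_continuous p (j : 'I_(nprong p)) : continuous (prong j).
Proof. by have [[_ pc _ _ _] _] := starP p; case: (pc j). Qed.

Lemma prong_inj p (j : 'I_(nprong p)) : inj_seg (prong j) 0 (radius p).
Proof. by have [st _] := starP p; exact: star_inj st. Qed.

Lemma prong_leaf p (j : 'I_(nprong p)) t : 0 <= t -> t < radius p -> F p (prong j t).
Proof. by have [[_ _ _ pL _] _] := starP p; exact: pL. Qed.

Lemma prong_initial g p (j : 'I_(nprong p)) t : continuous g -> inj_seg g 0 1 ->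
  g 0 = p -> 0 < t -> t < radius p -> prong j @` seg 0 t `<=` g @` seg 0 1 ->
  exists e : R, [/\ 0 < e, e <= 1 & prong j @` seg 0 t = g @` seg 0 e].
Proof.
move=> gc gi g0 t0 ta sub; have pi := @prong_inj p j.
have [e e01 ge] : (g @` seg 0 1) (prong j t) by apply: sub; exists t => //; seglra.
have e0 : 0 < e.
  rewrite lt_neqAle; apply/andP; split; last by case/andP: e01.
  apply/eqP => eE; move: ge; rewrite -eE g0 -{1}(prong0 j) => /pi te.
  have {}te : 0 = t by apply: te; seglra.
  by seglra.
exists e; split=> //; first by case/andP: e01.
apply: (arc_sub_eq hausS (@prong_continuous p j) gc gi) => //.
- by move=> u v hu hv; apply: pi; [move: hu|move: hv]; seglra.
- by seglra.
- by seglra.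
- by case/andP: e01.
- by rewrite prong0.
Qed.

Lemma germ_uniq I p x i j : leaf_arc R F I p x -> @germ p i I -> @germ p j I -> i = j.
Proof.
move=> /leaf_arcP[g [gc gi -> [g0 gy] gF]] [s [s0 sa Is]] [t [t0 ta It]].
have [e [e0 e1 Es]] := prong_initial gc gi g0 s0 sa Is.
have [d [d0 d1 Et]] := prong_initial gc gi g0 t0 ta It.
pose u := Num.min e d.
have [ue ud] : u <= e /\ u <= d by rewrite !ge_min !lexx orbT.
have u0 : 0 < u by rewrite lt_min e0.
have [v hv gv] : (prong i @` seg 0 s) (g u) by rewrite Es; exists u => //; seglra.
have [w hw gw] : (prong j @` seg 0 t) (g u) by rewrite Et; exists u => //; seglra.
have [[_ _ pi _ _] _] := starP p.
case: (pi i j v w); [by move: hv; seglra|by move: hw; seglra|by rewrite gv gw| |].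
  by case.
move=> [v0 _]; have /gi gu : g 0 = g u by rewrite g0 -gv v0 prong0.
have {}gu : 0 = u by apply: gu; seglra.
by exfalso; seglra.
Qed.

Lemma germ_sub I J p j : I `<=` J -> @germ p j I -> @germ p j J.
Proof. by move=> IJ [t [t0 ta H]]; exists t; split=> // x /H/IJ. Qed.

Variable Sg : set S.
Hypothesis Sg_fin : finite_set Sg.
Hypothesis Sg_star : forall w, ~ Sg w ->
  exists a (pr : 'I_2 -> R -> S), star (F w) w a pr.

(** Unique continuation needs two prongs only at the interior points of [J]. The asymmetry allows
    [I] to be a hypothetical connection between points of [Sg]. *)
Lemma germ_comparable I J p x y j : leaf_arc R F I p x -> leaf_arc R F J p y ->
  (forall w, J w -> Sg w -> w = p \/ w = y) -> @germ p j I -> @germ p j J ->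
  I `<=` J \/ J `<=` I.
Proof.
move=> /leaf_arcP[g [gc gi -> [g0 gy] gF]] /leaf_arcP[h [hc hi -> [h0 hy] hF]].
move=> reg [s [s0 sa Is]] [t [t0 ta It]].
have [u [u0 us ut]] : exists u, [/\ 0 < u, u <= s & u <= t].
  by exists (Num.min s t); rewrite lt_min s0 t0 !ge_min !lexx orbT.
have {Is} Iu : prong j @` seg 0 u `<=` g @` seg 0 1.
  by move=> _ [v hv <-]; apply: Is; exists v => //; move: hv; seglra.
have {It} Ju : prong j @` seg 0 u `<=` h @` seg 0 1.
  by move=> _ [v hv <-]; apply: It; exists v => //; move: hv; seglra.
have ua : u < radius p by lra.
have [e [e0 e1 Es]] := prong_initial gc gi g0 u0 ua Iu.
apply: (unique_continuation hausS Feq gc hc gi hi).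
- by rewrite g0 h0.
- by rewrite g0.
- by rewrite h0.
- by exists e; split=> //; rewrite -Es.
move=> v v0 v1; apply: Sg_star => /reg [|vp|vy].
- by exists v => //; seglra.
- have /hi v0E : h v = h 0 by rewrite vp h0.
  have {}v0E : v = 0 by apply: v0E; seglra.
  by seglra.
- have /hi v1E : h v = h 1 by rewrite vy hy.
  have {}v1E : v = 1 by apply: v1E; seglra.
  by seglra.
Qed.

Lemma finite_uniform (T : choiceType) (A : set T) (P : T -> R -> Prop) :
  finite_set A ->
  (forall x, A x -> exists2 e, 0 < e & forall d, 0 < d -> d <= e -> P x d) ->
  exists2 e, 0 < e & forall x d, A x -> 0 < d -> d <= e -> P x d.
Proof.
move=> /finite_seqP[s ->]; elim: s => [|x s IH] H.
  by exists 1 => // x d; rewrite /= in_nil.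
have [|e e0 He] := IH; first by move=> y /= ys; apply: H; rewrite /= in_cons ys orbT.
have [|d d0 Hd] := H x; first by rewrite /= mem_head.
exists (Num.min e d); first by rewrite lt_min e0.
move=> y c /=; rewrite in_cons le_min => /orP[/eqP ->|ys] c0 /andP[ce cd].
  exact: Hd.
exact: He.
Qed.

(** Take prong pieces at [p] too short to contain another point of [Sg]. An arc ending in [Sg] is
    comparable with the piece that it starts along but cannot lie inside it; so it contains the
    piece and is at least as long. *)
Lemma saddle_connection_len : exists2 e, 0 < e &
  forall I p q, Sg p -> Sg q -> leaf_arc R F I p q -> e <= m I.
Proof.
pose P p d := forall I q, Sg q -> leaf_arc R F I p q -> d <= m I.
have [p _|e e0 H] := @finite_uniform _ Sg P Sg_fin; last first.
  by exists e => // I p q Sp Sq; apply: H Sp _ _ I q Sq.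
have a0 : 0 < radius p by have [[]] := starP p.
(* [q] lies on the prongs at [p] for at most one positive parameter [s], and [s / 2] stays below it;
   when there is none, any bound will do. *)
have [q Sq|b b0 Hb] := @finite_uniform _ Sg
   (fun q d => forall j t, 0 < t -> t <= d -> t < radius p -> @prong p j t <> q) Sg_fin.
  have [[i [s [s0 sa psq]]]|no] := pselect (exists i s,
      [/\ 0 < s, s < radius p & @prong p i s = q]).
    exists (s / 2); first by lra.
    move=> d d0 ds j t t0 td ta ptq; have [[_ _ pi _ _] _] := starP p.
    case: (pi j i t s); [by seglra|by seglra|by rewrite ptq psq|case=> _ ts|case=> t0E].
      by seglra.
    by seglra.
  by exists 1 => // d _ _ j t t0 _ ta ptq; apply: no; exists j, t.
(* Half the radius, because the measure of a prong piece is prescribed only strictly inside the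
   chart. *)
pose c := Num.min b (radius p / 2).
have c0 : 0 < c by rewrite lt_min b0 /=; lra.
have [cb ca2] : c <= b /\ c <= radius p / 2 by rewrite !ge_min !lexx orbT.
have ca : c < radius p by lra.
exists c => // d d0 dc I q Sq pIq; apply: le_trans dc _.
have [j Ij] := germ_ex pIq.
have pJ : leaf_arc R F (prong j @` seg 0 c) p (prong j c).
  rewrite -{2}(prong0 j); apply: leaf_arc_seg => //.
  - exact: prong_continuous.
  - by move=> u v hu hv; apply: prong_inj; [move: hu|move: hv]; seglra.
  - by move=> t ht; rewrite prong0; apply: prong_leaf; move: ht; seglra.
have noS w : (prong j @` seg 0 c) w -> Sg w -> w = p.
  move=> [t ht <-] St; case: (eqVneq t 0) => [->|tN0]; first by rewrite prong0.
  exfalso; apply: (Hb _ b St b0 (lexx b) j t) => //; last 2 first.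
  - by move: ht; seglra.
  - by move: ht; seglra.
  by rewrite lt_neqAle eq_sym tN0; case/andP: ht.
have [||IJ|JI] := germ_comparable pIq pJ _ Ij.
- by move=> w Jw Sw; left; apply: noS.
- by exists c; split.
- have [g [gc gi gE [g0 g1] _]] := (leaf_arcP _ _ _).1 pIq.
  have /gi g10 : g 1 = g 0.
    by rewrite g1 g0; apply: noS => //; apply: IJ; rewrite gE -g1; exists 1 => //; seglra.
  have {}g10 : (1 : R) = 0 by apply: g10; seglra.
  by exfalso; seglra.
have mJ : m (prong j @` seg 0 c) = c by have [_ ->] := starP p; rewrite ?subr0.
rewrite -mJ; case: (leaf_arc_len_sub pJ pIq JI) => [->//|/ltW]; exact.
Qed.

End LeafLengths.

(** * Iterates of maps that contract lengths along leaves *)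

Section Dynamics.
Variables (R : realType) (S : topologicalType).
Implicit Types (F : S -> set S) (I J : set S) (f : S -> S).

Lemma exists_pow_lt (c x e : R) : 0 < c -> c < 1 -> 0 < e ->
  exists n, c ^+ n * x < e.
Proof.
move=> c0 c1 e0; have cvg : (fun n => c ^+ n * x) @ \oo --> (0 * x : R).
  by apply: cvgM; [apply: cvg_expr; rewrite ger0_norm ?ltW | exact: cvg_cst].
rewrite mul0r in cvg.
have [n _ H] := cvgr_lt _ cvg _ e0.
by exists n; apply: H => /=.
Qed.

Lemma is_arc_image f I x y : continuous f -> injective f -> is_arc R I x y ->
  is_arc R (f @` I) (f x) (f y).
Proof.
move=> fc fi /is_arcP[g [gc gi -> <- <-]]; apply/is_arcP; exists (f \o g).
split=> //; last by rewrite image_comp.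
  by move=> t; apply: continuous_comp; [exact: gc|exact: fc].
by move=> s t hs ht /fi/gi; apply.
Qed.

Lemma leaf_arc_image F f I x y : continuous f -> injective f ->
  (forall x y, F x y -> F (f x) (f y)) ->
  leaf_arc R F I x y -> leaf_arc R F (f @` I) (f x) (f y).
Proof.
move=> fc fi fF [Iarc IF]; split; first exact: is_arc_image.
by move=> _ [z /IF Fz <-]; exact: fF.
Qed.

Lemma iter_continuous f n : continuous f -> continuous (iter n f).
Proof.
move=> fc; elim: n => [|n IH] x; first exact: cvg_id.
by apply: (@continuous_comp _ _ _ (iter n f) f); [exact: IH|exact: fc].
Qed.

Lemma iter_inj f n : injective f -> injective (iter n f).
Proof. by move=> fi; elim: n => [|n IH] x y //= /fi/IH. Qed.

Lemma iter_leaf F f n : (forall x y, F x y -> F (f x) (f y)) ->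
  forall x y, F x y -> F (iter n f x) (iter n f y).
Proof. by move=> fF; elim: n => [|n IH] x y //= /IH/fF. Qed.

Lemma leaf_arc_iter F f n I x y : continuous f -> injective f ->
  (forall x y, F x y -> F (f x) (f y)) ->
  leaf_arc R F I x y -> leaf_arc R F (iter n f @` I) (iter n f x) (iter n f y).
Proof.
move=> fc fi fF; apply: leaf_arc_image.
- exact: iter_continuous.
- exact: iter_inj.
- exact: iter_leaf.
Qed.

Lemma iter0_image f I : iter 0 f @` I = I.
Proof. exact: image_id. Qed.

Lemma iter_image f n I : f @` (iter n f @` I) = iter n.+1 f @` I.
Proof. by rewrite image_comp. Qed.

Lemma len_iter F f (m : set S -> R) c n I x y : continuous f -> injective f ->
  (forall x y, F x y -> F (f x) (f y)) ->
  (forall I, interval_of R F I -> m (f @` I) = c * m I) ->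
  leaf_arc R F I x y -> m (iter n f @` I) = c ^+ n * m I.
Proof.
move=> fc fi fF fm Ixy; elim: n => [|n IH].
  by rewrite expr0 mul1r iter0_image.
rewrite -iter_image fm ?IH ?exprS ?mulrA //.
exists (iter n f x), (iter n f y); exact: leaf_arc_iter.
Qed.

End Dynamics.

Section NoSaddleConnection.
Variables (R : realType) (S : topologicalType) (F : S -> set S) (m : set S -> R).
Hypothesis hausS : hausdorff_space S.
Hypothesis Ffol : foliation R F.
Hypothesis madd : additive_on F m.
Variables (nprong : S -> nat) (radius : S -> R).
Variable prong : forall w, 'I_(nprong w) -> R -> S.
Hypothesis starP : forall w, measured_star F m w (radius w) (@prong w).
Variable Sg : set S.
Hypothesis Sg_fin : finite_set Sg.
Hypothesis Sg_star : forall w, ~ Sg w ->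
  exists a (pr : 'I_2 -> R -> S), star (F w) w a pr.
Variables (f : S -> S) (c : R).
Hypotheses (fc : continuous f) (fi : injective f).
Hypothesis fF : forall x y, F x y -> F (f x) (f y).
Hypothesis fSg : forall x, Sg x -> Sg (f x).
Hypotheses (c0 : 0 < c) (c1 : c < 1).
Hypothesis fm : forall I, interval_of R F I -> m (f @` I) = c * m I.

(* Iterating [f] would produce arbitrarily short saddle connections. *)
Lemma no_saddle_connection I p q : Sg p -> Sg q -> ~ leaf_arc R F I p q.
Proof.
move=> Sp Sq Ipq.
have [e e0 He] := saddle_connection_len hausS Ffol madd starP Sg_fin Sg_star.
have [n Hn] := exists_pow_lt (m I) c0 c1 e0.
have iSg x : Sg x -> Sg (iter n f x).
  by elim: n {Hn} => //= n IH /IH/fSg.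
have := He _ _ _ (iSg _ Sp) (iSg _ Sq) (leaf_arc_iter n fc fi fF Ipq).
by rewrite (len_iter n fc fi fF fm Ipq) leNgt Hn.
Qed.

(** The part of the arc up to another point of [Sg] would itself be a saddle connection. *)
Lemma regular_leaf_arc I p x : Sg p -> ~ Sg x -> leaf_arc R F I p x ->
  forall w, I w -> Sg w -> w = p.
Proof.
move=> Sp nSx /leaf_arcP[g [gc gi -> [g0 g1] gF]] _ [t ht <-] St.
case: (eqVneq t 0) => [->//|tN0].
have t0 : 0 < t by rewrite lt_neqAle eq_sym tN0; case/andP: ht.
exfalso; apply: (@no_saddle_connection (g @` seg 0 t) p (g t)) => //.
rewrite -g0; apply: leaf_arc_seg => //.
  by move=> u v hu hv; apply: gi; [move: hu|move: hv]; move: ht; seglra.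
by move=> u hu; rewrite g0; apply: gF; move: hu ht; seglra.
Qed.

End NoSaddleConnection.

(** * Finiteness of the orbits of crossings *)

Section ArcLabels.
Variables (R : realType) (S : topologicalType) (F : S -> set S) (Sg : set S).

Definition ray_arc I p x := [/\ Sg p, ~ Sg x & leaf_arc R F I p x].

Definition comparable (I J : set S) := I `<=` J \/ J `<=` I.

(** [lab p] classifies the arcs of [ray_arc] that start at [p]; there are [N p]
    classes, one for each prong at [p]. *)
Definition classifies (N : S -> nat) (lab : S -> set S -> nat) : Prop :=
  (forall I p x, ray_arc I p x -> (lab p I < N p)%N) /\
  (forall I J p x y, ray_arc I p x -> ray_arc J p y ->
     lab p I = lab p J <-> comparable I J).

Lemma ray_arc_image (f : S -> S) I p x : continuous f -> injective f ->
  (forall x y, F x y -> F (f x) (f y)) -> (forall x, Sg (f x) <-> Sg x) ->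
  ray_arc I p x -> ray_arc (f @` I) (f p) (f x).
Proof.
move=> fc fi fF fS [Sp Sx Ipx]; split; [exact/fS|by move/fS|].
exact: leaf_arc_image.
Qed.

Lemma comparable_image (f : S -> S) I J : comparable I J ->
  comparable (f @` I) (f @` J).
Proof. by case=> H; [left|right]; exact: image_subset. Qed.

Lemma image_inj_subset (f : S -> S) I J : injective f -> f @` I `<=` f @` J -> I `<=` J.
Proof. by move=> fi H x Ix; have [y Jy /fi <-] := H _ (imageP f Ix). Qed.

Lemma comparable_image_inv (f : S -> S) I J : injective f ->
  comparable (f @` I) (f @` J) -> comparable I J.
Proof. by move=> fi [] /(image_inj_subset fi); [left|right]. Qed.

End ArcLabels.

(** The label is the number of the initial prong. Equal prongs give nested arcs by unique
    continuation, as such an arc meets [Sg] only at its origin; conversely nested arcs share their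
    germ. The contraction [f] enters by ruling out saddle connections. *)
Lemma ex_classifies (R : realType) (S : topologicalType) (F : S -> set S)
    (m : set S -> R) (nprong : S -> nat) (radius : S -> R)
    (prong : forall w, 'I_(nprong w) -> R -> S) (Sg : set S) (f : S -> S) (c : R) :
  hausdorff_space S -> foliation R F -> additive_on F m ->
  (forall w, measured_star F m w (radius w) (@prong w)) -> finite_set Sg ->
  (forall w, ~ Sg w -> exists a (pr : 'I_2 -> R -> S), star (F w) w a pr) ->
  continuous f -> injective f -> (forall x y, F x y -> F (f x) (f y)) ->
  (forall x, Sg x -> Sg (f x)) -> 0 < c -> c < 1 ->
  (forall I, interval_of R F I -> m (f @` I) = c * m I) ->
  exists lab, classifies R F Sg nprong lab.
Proof.
move=> hS Ffol madd stP Sfin Sst fc fi fF fS c0 c1 fm.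
(* The prong does not depend on the endpoint [x], so the choice is made over pairs [(p, I)]; pairs
   that are not arcs get the value [0]. *)
have /choice[lab labP] : forall pI : S * set S, exists n : nat,
    forall x, leaf_arc R F pI.2 pI.1 x ->
      exists2 j : 'I_(nprong pI.1), n = j & germ radius prong j pI.2.
  move=> [p I] /=; have [[x Ix]|no] := pselect (exists x, leaf_arc R F I p x).
    have [j Ij] := germ_ex hS stP Ix.
    by exists j => y _; exists j.
  by exists 0%N => x Ix; case: no; exists x.
exists (fun p I => lab (p, I)); split.
  by move=> I p x [_ _ Ix]; have [j -> _] := labP (p, I) x Ix.
move=> I J p x y [Sp Sx Ix] [_ Sy Jy].
have [i -> gi] := labP (p, I) x Ix; have [j -> gj] := labP (p, J) y Jy.
rewrite /= in i gi j gj *; split=> [ij|].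
  have {}ij : i = j by apply/val_inj.
  rewrite -ij in gj.
  apply: (germ_comparable hS Ffol stP Sst Ix Jy _ gi gj).
  move=> w Jw Sw; left.
  by apply: (regular_leaf_arc hS Ffol madd stP Sfin Sst fc fi fF fS c0 c1 fm Sp Sy Jy).
move=> [] H; congr val.
  apply: (germ_uniq hS stP Jy) => //; exact: germ_sub gi.
apply: (germ_uniq hS stP Ix) => //; exact: germ_sub gj.
Qed.

Section Orbits.
Variables (R : realType) (S : topologicalType) (Fs Fu : S -> set S) (Sg : set S).
Variable m : set S -> R.
Variables (Ns Nu : S -> nat) (labs labu : S -> set S -> nat).
Hypothesis Sg_fin : finite_set Sg.
Hypothesis labsP : classifies R Fs Sg Ns labs.
Hypothesis labuP : classifies R Fu Sg Nu labu.
Hypothesis m_gt0 : forall I p x, leaf_arc R Fs I p x -> 0 < m I.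
Hypothesis m_sub : forall I J p x y, leaf_arc R Fs I p x -> leaf_arc R Fs J p y ->
  I `<=` J -> I = J \/ m I < m J.
Hypothesis cross_fin : forall I J p q x y,
  leaf_arc R Fs I p x -> leaf_arc R Fu J q y -> finite_set (I `&` J).

Definition first_crossing I J p q x :=
  [/\ ray_arc R Fs Sg I p x, ray_arc R Fu Sg J q x & (I `\ p) `&` (J `\ q) = [set x]].

(** Stated for a general map so that it applies to [f] and also to the power of [f] that fixes the
    origins and the prongs. *)
Definition leaf_contraction (h : S -> S) c :=
  [/\ [/\ continuous h, injective h & forall x, Sg (h x) <-> Sg x],
      forall x y, Fs x y -> Fs (h x) (h y),
      forall x y, Fu x y -> Fu (h x) (h y), 0 < c /\ c < 1 &
      forall I, interval_of R Fs I -> m (h @` I) = c * m I].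

Lemma first_crossing_image h c I J p q x : leaf_contraction h c ->
  first_crossing I J p q x ->
  first_crossing (h @` I) (h @` J) (h p) (h q) (h x).
Proof.
move=> [[hc hi hS] hs hu _ _] [Ix Jx IJ]; split; try exact: ray_arc_image.
apply/seteqP; split.
  move=> _ [[[y Iy <-] yp] [[z Jz /hi zy] yq]].
  have -> : y = x => //; suff : [set x] y by [].
  rewrite -IJ; split; split=> //; first by move=> E; apply: yp; rewrite E.
    by rewrite -zy.
  by move=> E; apply: yq; rewrite E.
move=> _ ->; have : [set x] x by []. rewrite -{1}IJ => -[[Ix' xp] [Jx' xq]].
by split; split; try (by exists x); move=> /hi.
Qed.

Lemma contraction_iter h c n : (0 < n)%N -> leaf_contraction h c ->
  leaf_contraction (iter n h) (c ^+ n).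
Proof.
move=> n0 [[hc hi hS] hs hu [c0 c1] hm]; split.
- split; [exact: iter_continuous|exact: iter_inj|].
  by elim: n {n0} => //= n IH x; rewrite hS.
- exact: iter_leaf.
- exact: iter_leaf.
- by rewrite exprn_gt0 // exprn_ilt1 // ?ltW // -lt0n.
- by move=> I [x [y Ixy]]; apply: (len_iter n hc hi hs hm Ixy).
Qed.

Lemma first_crossing_iter h c n I J p q x : leaf_contraction h c ->
  first_crossing I J p q x ->
  first_crossing (iter n h @` I) (iter n h @` J) (iter n h p) (iter n h q) (iter n h x).
Proof.
move=> hc Ix; elim: n => [|n IH]; first by rewrite !iter0_image.
by rewrite -!iter_image; exact: (first_crossing_image hc IH).
Qed.

(** Images of nested arcs are nested, so a class that [h] preserves for one arc [I] is preserved for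
    every arc in it, and under all iterates. *)
Lemma label_iter F N lab h n I J p x y : classifies R F Sg N lab ->
  continuous h -> injective h -> (forall x y, F x y -> F (h x) (h y)) ->
  (forall x, Sg (h x) <-> Sg x) -> h p = p ->
  ray_arc R F Sg I p x -> ray_arc R F Sg J p y ->
  lab p (h @` I) = lab p I -> lab p J = lab p I ->
  lab p (iter n h @` J) = lab p I.
Proof.
move=> [_ labP] hc hi hF hS hp Ix Jy hI JI.
elim: n => [|n IH]; first by rewrite iter0_image.
have Jn : ray_arc R F Sg (iter n h @` J) p (iter n h y).
  elim: {IH} n => [|n IHn]; first by rewrite iter0_image.
  by rewrite -iter_image -{1}hp; apply: ray_arc_image.
rewrite -iter_image -hI.
have K1 : ray_arc R F Sg (h @` (iter n h @` J)) p (h (iter n h y)).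
  by rewrite -{1}hp; apply: ray_arc_image.
have K2 : ray_arc R F Sg (h @` I) p (h x) by rewrite -{1}hp; apply: ray_arc_image.
by apply/(labP _ _ _ _ _ K1 K2)/comparable_image/(labP _ _ _ _ _ Jn Ix).
Qed.

(* Normalise [x] by powers of [h] so that its stable arc lies between [h I0]
   and [I0]. If the unstable arc of [x] were longer than [h J0], it would meet
   that stable arc in the point [h x0] before reaching [x]. *)
Lemma class_orbit h c I0 J0 p q x0 I J x : leaf_contraction h c ->
  h p = p -> h q = q ->
  first_crossing I0 J0 p q x0 -> first_crossing I J p q x ->
  labs p (h @` I0) = labs p I0 -> labu q (h @` J0) = labu q J0 ->
  labs p I = labs p I0 -> labu q J = labu q J0 ->
  exists a b y, (I0 `&` (h @` J0)) y /\ iter a h x = iter b h y.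
Proof.
move=> hc hp hq X0 X hI0 hJ0 II0 JJ0.
have [[hcont hi hS] hs hu [c0 c1] hm] := hc.
have [I0x J0x _] := X0; have [Ix Jx _] := X.
have [_ _ lI0] := I0x; have [_ _ lI] := Ix.
(* [I0] is shrunk first, below the length of [I], so that only nonnegative powers of [h] have to be
   applied to [I]. *)
have [b Hb] := exists_pow_lt (m I0) c0 c1 (m_gt0 lI).
pose t := c ^+ b * m I0.
have t0 : 0 < t by rewrite mulr_gt0 ?exprn_gt0 ?(m_gt0 lI0).
have exa : exists a, c ^+ a * m I <= t.
  by have [a Ha] := exists_pow_lt (m I) c0 c1 t0; exists a; exact: ltW.
(* The first power that brings [I] down to length at most [t]. By minimality it does not overshoot
   by more than one factor [c]; for [a = 0] the choice of [b] gives the lower bound. *)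
pose a := ex_minn exa.
have [at_ amin] : c ^+ a * m I <= t /\ (forall n, c ^+ n * m I <= t -> (a <= n)%N).
  by rewrite /a; case: ex_minnP.
have lower : c * t <= c ^+ a * m I.
  have ct : c * t < t by rewrite gtr_pMl.
  case: a at_ amin => [|n] _ amin.
    by rewrite expr0 mul1r; apply: ltW (lt_trans ct Hb).
  rewrite exprS -mulrA ler_pM2l //; case: (ltP t (c ^+ n * m I)) => [/ltW//|/amin].
  by rewrite ltnn.
have iterfix n z : h z = z -> iter n h z = z by move=> hz; elim: n => //= n ->.
have raysI n K z : ray_arc R Fs Sg K p z -> ray_arc R Fs Sg (iter n h @` K) p (iter n h z).
  move=> Kz; rewrite -{1}(iterfix n p hp); apply: ray_arc_image Kz.
  - exact: iter_continuous.
  - exact: iter_inj.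
  - exact: iter_leaf.
  - by elim: n => //= n IHn w; rewrite hS.
have raysJ n K z : ray_arc R Fu Sg K q z -> ray_arc R Fu Sg (iter n h @` K) q (iter n h z).
  move=> Kz; rewrite -{1}(iterfix n q hq); apply: ray_arc_image Kz.
  - exact: iter_continuous.
  - exact: iter_inj.
  - exact: iter_leaf.
  - by elim: n => //= n IHn w; rewrite hS.
have ls n : labs p (iter n h @` I) = labs p I0.
  exact: (label_iter n labsP hcont hi hs hS hp I0x Ix).
have ls0 n : labs p (iter n h @` I0) = labs p I0.
  exact: (label_iter n labsP hcont hi hs hS hp I0x I0x).
have lu n : labu q (iter n h @` J) = labu q J0.
  exact: (label_iter n labuP hcont hi hu hS hq J0x Jx).
have lu0 n : labu q (iter n h @` J0) = labu q J0.
  exact: (label_iter n labuP hcont hi hu hS hq J0x J0x).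
have mI n : m (iter n h @` I) = c ^+ n * m I := len_iter n hcont hi hs hm lI.
have mI0 n : m (iter n h @` I0) = c ^+ n * m I0 := len_iter n hcont hi hs hm lI0.
(* Equal labels make the arcs nested, and the lengths tell in which direction. *)
have sub K L z w : ray_arc R Fs Sg K p z -> ray_arc R Fs Sg L p w ->
    labs p K = labs p L -> m K <= m L -> K `<=` L.
  move=> Kz Lw /(labsP.2 _ _ _ _ _ Kz Lw)[//|LK] KL.
  have [_ _ lK] := Kz; have [_ _ lL] := Lw.
  by case: (m_sub lL lK LK) => [->//|]; rewrite ltNge KL.
have upI : iter a h @` I `<=` iter b h @` I0.
  by apply: (sub _ _ _ _ (raysI a _ _ Ix) (raysI b _ _ I0x)); rewrite ?ls ?ls0 ?mI ?mI0.
have downI : iter b.+1 h @` I0 `<=` iter a h @` I.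
  apply: (sub _ _ _ _ (raysI b.+1 _ _ I0x) (raysI a _ _ Ix)); rewrite ?ls ?ls0 //.
  by rewrite mI mI0 exprS -mulrA.
have X1 := first_crossing_iter a hc X; have X01 := first_crossing_iter b.+1 hc X0.
rewrite !(iterfix _ p hp) !(iterfix _ q hq) in X1 X01.
have [[[Sp nSx _] _ X1E] [[_ nS01 _] _ X01E]] := (X1, X01).
have Sq : Sg q by case: Jx.
have [[aIx _] [aJx _]] : ((iter a h @` I) `\ p) (iter a h x) /\
    ((iter a h @` J) `\ q) (iter a h x).
  by suff : [set iter a h x] (iter a h x) by rewrite -{1}X1E => -[].
have [[bIx _] [bJx _]] : ((iter b.+1 h @` I0) `\ p) (iter b.+1 h x0) /\
    ((iter b.+1 h @` J0) `\ q) (iter b.+1 h x0).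
  by suff : [set iter b.+1 h x0] (iter b.+1 h x0) by rewrite -{1}X01E => -[].
have inJ : (iter b.+1 h @` J0) (iter a h x).
  have /(labuP.2 _ _ _ _ _ (raysJ a _ _ Jx) (raysJ b.+1 _ _ J0x)) [] : 
    labu q (iter a h @` J) = labu q (iter b.+1 h @` J0) by rewrite lu lu0.
    by apply.
  (* In the other nesting, the image of [x0] lies on both arcs of the image of [x]. First
     intersection makes the two points equal, and the membership holds all the same. *)
  move=> J0J; have : [set iter a h x] (iter b.+1 h x0).
    rewrite -X1E; split; split; [exact: downI| |exact: J0J|].
      by move=> E; apply: nS01; rewrite E.
    by move=> E; apply: nS01; rewrite E.
  by move=> /= <-.
have [y I0y yx] := upI _ aIx.
exists a, b, y; split=> //; split=> //.
(* Both memberships are pulled back by the injective [iter b h], which leaves one application of [h]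
   on [J0]. *)
move: inJ => [w J0w]; rewrite iterSr -yx => /(iter_inj hi) wy.
by exists w.
Qed.

Lemma pigeonhole (T : choiceType) (A : set T) (u : nat -> T) : finite_set A ->
  (forall n, A (u n)) -> exists a b, (a < b)%N /\ u a = u b.
Proof.
move=> Afin Au; apply: contrapT => no; apply: infinite_nat.
have <- : u @^-1` A = [set: nat] by apply/seteqP; split=> // n _; exact: Au.
apply: finite_preimage Afin => a b _ _ uab.
case: (ltngtP a b) => // [ab|ba]; exfalso; apply: no; first by exists a, b.
by exists b, a.
Qed.

Let label I J (p q : S) := (p, q, labs p I, labu q J).

(** Each of the finitely many labels that occur contributes the crossings of two fixed arcs. Lying
    on one orbit is written with nonnegative powers on both sides, which avoids inverse iterates. *)
Lemma finite_orbits f c : leaf_contraction f c -> exists E, finite_set E /\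
  forall I J p q x, first_crossing I J p q x ->
    exists a b y, E y /\ iter a f x = iter b f y.
Proof.
move=> fc.
pose L := \bigcup_(p in Sg) \bigcup_(q in Sg) \bigcup_(i in `I_(Ns p))
  \bigcup_(j in `I_(Nu q)) [set (p, q, i, j)].
have Lfin : finite_set L.
  apply: bigcup_finite => // p _; apply: bigcup_finite => // q _.
  apply: bigcup_finite => [|i _]; first exact: finite_II.
  apply: bigcup_finite => [|j _]; first exact: finite_II.
  exact: finite_set1.
have inL I J p q x : first_crossing I J p q x -> L (label I J p q).
  move=> [Ix Jx _]; have [Sp _ _] := Ix; have [Sq _ _] := Jx.
  exists p => //; exists q => //; exists (labs p I); first exact: labsP.1 Ix.
  by exists (labu q J) => //; exact: labuP.1 Jx.
have /choice[E HE] : forall l, exists E, finite_set E /\ forall I J p q x,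
    first_crossing I J p q x -> label I J p q = l ->
    exists a b y, E y /\ iter a f x = iter b f y.
  move=> l; have [[I0 [J0 [p [q [x0 [X0 l0]]]]]]|no] :=
    pselect (exists I J p q x, first_crossing I J p q x /\ label I J p q = l); last first.
    exists set0; split=> // I J p q x X Xl; exfalso; apply: no.
    by exists I, J, p, q, x.
  (* The images of one crossing take finitely many labels, so two times [a < b] share one.
     Injectivity of [f] carries this back to times [0] and [M = b - a]: [iter M f] fixes [p], [q]
     and both classes. *)
  have [a [b [ab]]] := pigeonhole
    (u := fun n => label (iter n f @` I0) (iter n f @` J0) (iter n f p) (iter n f q))
    Lfin (fun n => inL _ _ _ _ _ (first_crossing_iter n fc X0)).
  move=> [pab qab].
  rewrite -pab -qab => sab uab.
  have [[fcont fi _] _ _ _ _] := fc.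
  have M0 : (0 < b - a)%N by rewrite subn_gt0.
  have bE : b = (a + (b - a))%N by rewrite subnKC // ltnW.
  set M := (b - a)%N in M0 bE.
  have hM := contraction_iter M0 fc.
  have XM := first_crossing_image hM X0.
  have hp : iter M f p = p.
    by apply: (iter_inj (n := a) fi); rewrite -iterD -bE.
  have hq : iter M f q = q.
    by apply: (iter_inj (n := a) fi); rewrite -iterD -bE.
  have itE K : iter b f @` K = iter a f @` (iter M f @` K).
    by rewrite image_comp bE; congr (_ @` _); apply/funext => z; rewrite /= iterD.
  have Xa := first_crossing_iter a fc X0.
  have Xb := first_crossing_iter b fc X0; rewrite -pab -qab in Xb.
  rewrite hp hq in XM.
  have [[I0x J0x _] [IMx JMx _]] := (X0, XM).
  have [[Iax Jax _] [Ibx Jbx _]] := (Xa, Xb).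
  (* Labels at different origins cannot be transported directly; comparability can, through the
     injective [iter a f]. *)
  have sM : labs p (iter M f @` I0) = labs p I0.
    apply/(labsP.2 _ _ _ _ _ IMx I0x)/(comparable_image_inv (iter_inj (n := a) fi)).
    by rewrite -itE; apply/(labsP.2 _ _ _ _ _ Ibx Iax).
  have uM : labu q (iter M f @` J0) = labu q J0.
    apply/(labuP.2 _ _ _ _ _ JMx J0x)/(comparable_image_inv (iter_inj (n := a) fi)).
    by rewrite -itE; apply/(labuP.2 _ _ _ _ _ Jbx Jax).
  exists (I0 `&` (iter M f @` J0)); split.
    by have [_ _ lI] := I0x; have [_ _ lJ] := JMx; exact: cross_fin lI lJ.
  move=> I J p' q' x X; rewrite -l0 => -[pE qE]; rewrite pE qE in X * => sE uE.
  have [a' [b' [y [Ey xy]]]] := class_orbit hM hp hq X0 X sM uM sE uE.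
  exists (a' * M)%N, (b' * M)%N, y; split=> //.
  by move: xy; rewrite -!iterM.
exists (\bigcup_(l in L) E l); split.
  by apply: bigcup_finite => // l _; case: (HE l).
move=> I J p q x X; have [_ H] := HE (label I J p q).
have [a [b [y [Ey xy]]]] := H _ _ _ _ _ X erefl.
by exists a, b, y; split=> //; exists (label I J p q) => //; exact: inL X.
Qed.

End Orbits.

Ltac boxlra := rewrite ?/half_box ?/closed_half_box ?/seg /=; seglra.

(** * Prong charts *)

Section ChartStars.
Variables (R : realType) (S : topologicalType) (Fs Fu : S -> set S).
Implicit Types (a b c d s t : R) (g h : R -> S).

Lemma path_component_subset (A B : set S) x y : A `<=` B ->
  path_component R A x y -> path_component R B x y.
Proof. by move=> AB [g [gc gA g0 g1]]; exists g; split=> // z /gA/AB. Qed.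

Lemma path_component_end (A : set S) x y : path_component R A x y -> A y.
Proof.
move=> [g [_ gA _ <-]]; apply: gA; exists 1 => //=.
by rewrite in_itv /= ler01 lexx.
Qed.

Lemma path_componentP (A : set S) x y : path_component R A x y <->
  exists g, [/\ continuous g, forall t, A (g t), g 0 = x & g 1 = y].
Proof.
have s0 : seg (0:R) 1 0 by seglra.
have s1 : seg (0:R) 1 1 by seglra.
split=> [[g [gc gA <- <-]]|[g [gc gA <- <-]]].
  exists (g \o clamp 0 1); split.
  - exact: clamp_arc.
  - by move=> t; apply: gA; exists (clamp 0 1 t) => //; rewrite -segE; exact: clamp_seg.
  - by rewrite /= clampE.
  - by rewrite /= clampE.
exists g; split=> //; first exact: continuous_subspaceT.
by move=> _ [t _ <-].
Qed.

(** Running along [g] itself joins [p] to [g t] inside [U] for small [t], so the chart description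
    of plaques applies to [g]. *)
Lemma chart_capture (L U : set S) p g : open U -> U p -> continuous g -> g 0 = p ->
  (forall t, L (g t)) ->
  exists2 e, 0 < e & forall t, seg 0 e t -> path_component R (L `&` U) p (g t).
Proof.
move=> oU Up gc g0 gL.
have : nbhs (0 : R) (g @^-1` U) by apply: gc; rewrite g0; exact: open_nbhs_nbhs.
move=> /nbhs_ballP[e /= e0 He]; exists (e / 2); first by rewrite divr_gt0.
move=> t ht; apply/path_componentP; exists (fun s => g (clamp 0 t (s * t))).
have t0 : 0 <= t by case/andP: ht.
split.
- move=> s; apply: (@continuous_comp _ _ _ (fun s => clamp 0 t (s * t)) g).
    apply: (@continuous_comp _ _ _ (fun s => s * t) (clamp 0 t)).
      by apply: cvgM; [exact: cvg_id|exact: cvg_cst].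
    exact: clamp_continuous.
  exact: gc.
- move=> s; split=> //; apply: He; rewrite /ball /= sub0r normrN.
  have := clamp_seg (s * t) t0; move: ht; seglra => /andP[_ te] /andP[s0 st].
  by rewrite ger0_norm //; lra.
- by rewrite mul0r clampE //; seglra.
- by rewrite mul1r clampE //; seglra.
Qed.

Lemma half_box0 a : 0 < a -> half_box a ((0, 0) : R * R).
Proof. by move=> a0; rewrite /half_box /=; split; lra. Qed.

Lemma half_box_closed a (u : R * R) : half_box a u -> closed_half_box a u.
Proof. by boxlra. Qed.

Lemma continuous_pair (T U V : topologicalType) (f : T -> U) (g : T -> V) :
  continuous f -> continuous g -> continuous (fun x => (f x, g x)).
Proof. by move=> fc gc x; exact: cvg_pair (fc x) (gc x). Qed.

Lemma clamp_pair_continuous a b (c : R) :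
  continuous (fun t => (clamp a b t, c)) /\ continuous (fun t => (c, clamp a b t)).
Proof.
by split; apply: continuous_pair; (exact: clamp_continuous || (move=> ?; exact: cvg_cst)).
Qed.

Lemma prong_chart_center k p a (phi : 'I_k -> R * R -> S) :
  prong_chart Fs Fu p a phi -> (\bigcup_j (phi j @` half_box a)) p.
Proof.
move=> [[k0 a0] phic _ _ _]; exists (Ordinal k0) => //.
by exists (0, 0); [exact: half_box0|case: (phic (Ordinal k0))].
Qed.

(** One prong for each half plane, its positive half axis: the negative half axis is glued to the
    positive one of the next half plane. At a spine the axis is folded onto a single prong. *)
Lemma horizontal_star k p a (phi : 'I_k -> R * R -> S) :
  prong_chart Fs Fu p a phi ->
  star (Fs p) p a (fun j t => phi j (clamp 0 a t, 0)).
Proof.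
move=> pc; have Up := prong_chart_center pc.
have [[k0 a0] phic phii Uo phiF] := pc.
have phi0 j : phi j (0, 0) = p by case: (phic j).
have cl j : continuous (fun t => phi j (clamp 0 a t, 0)).
  apply: within_comp (phic j).1 (clamp_pair_continuous 0 a 0).1 _ => t.
  by have := clamp_seg t (ltW a0); boxlra.
have hb t : 0 <= t -> t < a -> half_box a (t, 0) by boxlra.
split=> //.
- by move=> j; split=> //; rewrite clampE ?phi0 //; seglra.
- move=> i j s t hs ht; rewrite !clampE // => /phii[].
  + by move: hs; boxlra.
  + by move: ht; boxlra.
  + by move=> [-> [->]]; left.
  + by move=> [[->] [->]]; right.
  + by move=> [_ _ _ /= t0 st]; right; move: hs ht; seglra; split; lra.
  + by move=> [_ _ _ /= t0 st]; right; move: hs ht; seglra; split; lra.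
- move=> j t t0 ta; rewrite clampE; last by seglra.
  have [[_ H] _] := phiF j j (0, 0) (t, 0) (half_box0 a0) (hb _ t0 ta).
  have /path_component_end[] := H (or_introl (conj erefl erefl)).
  by rewrite phi0.
- move=> g gc g0 gL; have [e e0 He] := chart_capture Uo Up gc g0 gL.
  exists e => // t /He; set U := (X in _ `&` X) => pt.
  have [_ [j _ [v hv vt]]] := path_component_end pt.
  rewrite -vt -(phi0 j) in pt.
  have v2 : v.2 = 0.
    have [[H _] _] := phiF j j (0, 0) v (half_box0 a0) hv.
    by have [[_ <-]//|[_ ->]] := H pt.
  have [v10|v10] := leP 0 v.1.
    exists j, v.1; split=> //; first by move: hv; boxlra.
    rewrite -vt clampE; last by move: hv; boxlra.
    by rewrite -v2; case: (v).
  exists (ordS j), (- v.1); split; [seglra|by move: hv; boxlra|].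
  rewrite clampE; last by move: hv; boxlra.
  rewrite -vt; apply/phii.
  + exact: half_box_closed.
  + by move: hv; boxlra.
  + by apply: Or43; split=> //=; rewrite ?opprK //; lra.
Qed.

Lemma vertical_star k p a (phi : 'I_k -> R * R -> S) :
  prong_chart Fs Fu p a phi ->
  star (Fu p) p a (fun j t => phi j (0, clamp 0 a t)).
Proof.
move=> pc; have Up := prong_chart_center pc.
have [[k0 a0] phic phii Uo phiF] := pc.
have phi0 j : phi j (0, 0) = p by case: (phic j).
have cl j : continuous (fun t => phi j (0, clamp 0 a t)).
  apply: within_comp (phic j).1 (clamp_pair_continuous 0 a 0).2 _ => t.
  by have := clamp_seg t (ltW a0); boxlra.
have hb t : 0 <= t -> t < a -> half_box a (0, t) by boxlra.
split=> //.
- by move=> j; split=> //; rewrite clampE ?phi0 //; seglra.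
- move=> i j s t hs ht; rewrite !clampE // => /phii[].
  + by move: hs; boxlra.
  + by move: ht; boxlra.
  + by move=> [-> [->]]; left.
  + by move=> [[->] [->]]; right.
  + by move=> [_ /= -> -> _ _]; right.
  + by move=> [_ /= -> -> _ _]; right.
- move=> j t t0 ta; rewrite clampE; last by seglra.
  have [_ [_ H]] := phiF j j (0, 0) (0, t) (half_box0 a0) (hb _ t0 ta).
  have /path_component_end[] := H (Or41 _ _ _ (conj erefl erefl)).
  by rewrite phi0.
- move=> g gc g0 gL; have [e e0 He] := chart_capture Uo Up gc g0 gL.
  exists e => // t /He; set U := (X in _ `&` X) => pt.
  have [_ [j _ [v hv vt]]] := path_component_end pt.
  rewrite -vt -(phi0 j) in pt.
  have v1 : v.1 = 0.
    have [_ [H _]] := phiF j j (0, 0) v (half_box0 a0) hv.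
    have [[_ /= <-]//|[_ ->]//|[_ /= ? ?]|[_ /= ? ?]] := H pt; lra.
  exists j, v.2; split; [by move: hv; boxlra|by move: hv; boxlra|].
  rewrite -vt clampE; last by move: hv; boxlra.
  by rewrite -v1; case: (v).
Qed.

Lemma normalized_horizontal_star mus muu k p a (phi : 'I_k -> R * R -> S) :
  normalized_chart Fs Fu mus muu p a phi ->
  measured_star Fs muu p a (fun j t => phi j (clamp 0 a t, 0)).
Proof.
move=> [pc _ Hu]; split; first exact: horizontal_star.
have [[k0 a0] _ _ _ _] := pc.
move=> j c d c0 cd da; rewrite -(Hu j 0 c d); try lra.
congr muu; apply/seteqP; split=> [_ [t ht <-]|_ [[x y] /= [-> hx] <-]].
  exists (t, 0); first by move: ht; boxlra.
  by rewrite clampE //; move: ht; boxlra.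
exists x; first exact: hx.
by rewrite clampE //; move: hx; boxlra.
Qed.

Lemma normalized_vertical_star mus muu k p a (phi : 'I_k -> R * R -> S) :
  normalized_chart Fs Fu mus muu p a phi ->
  measured_star Fu mus p a (fun j t => phi j (0, clamp 0 a t)).
Proof.
move=> [pc Hs _]; split; first exact: vertical_star.
have [[k0 a0] _ _ _ _] := pc.
move=> j c d c0 cd da; rewrite -(Hs j 0 c d); try lra.
congr mus; apply/seteqP; split=> [_ [t ht <-]|_ [[x y] /= [-> hx] <-]].
  exists (0, t); first by move: ht; boxlra.
  by rewrite clampE //; move: ht; boxlra.
exists y; first exact: hx.
by rewrite clampE //; move: hx; boxlra.
Qed.

Lemma chart_capture2 (L U : set S) p g t0 : open U -> U p -> continuous g ->
  g t0 = p -> (forall t, L (g t)) ->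
  exists2 e, 0 < e &
    forall t, `|t - t0| <= e -> path_component R (L `&` U) p (g t).
Proof.
move=> oU Up gc g0 gL.
have H (s : R) : exists2 e, 0 < e & forall t, seg 0 e t ->
    path_component R (L `&` U) p (g (t0 + t * s)).
  apply: (chart_capture (g := fun t => g (t0 + t * s)) oU Up) => //.
    move=> t; apply: (@continuous_comp _ _ _ (fun t => t0 + t * s) g); last exact: gc.
    apply: cvgD; first exact: cvg_cst.
    by apply: cvgM; [exact: cvg_id|exact: cvg_cst].
  by rewrite mul0r addr0.
have [[e e0 He] [d d0 Hd]] := (H 1, H (-1)).
exists (Num.min e d); first by rewrite lt_min e0.
move=> t; rewrite le_min ler_norml ler_norml => /andP[/andP[e1 e2] /andP[d1 d2]].
case: (leP t0 t) => tt.
  have -> : t = t0 + (t - t0) * 1 by lra.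
  by apply: He; seglra.
have -> : t = t0 + (t0 - t) * -1 by lra.
by apply: Hd; seglra.
Qed.

Hypothesis hausS : hausdorff_space S.

(** In the chart the stable plaque of [p] is the set [y = 0] and the unstable one the set [x = 0],
    whatever the number of prongs; they share only the center. *)
Lemma local_crossing k p a (phi : 'I_k -> R * R -> S) g h t0 s0 :
  prong_chart Fs Fu p a phi -> continuous g -> continuous h ->
  (forall t, Fs p (g t)) -> (forall t, Fu p (h t)) -> g t0 = p -> h s0 = p ->
  exists2 e, 0 < e & forall t s, `|t - t0| <= e -> `|s - s0| <= e ->
    g t = h s -> g t = p.
Proof.
move=> pc gc hc gF hF gp hp; have Up := prong_chart_center pc.
have [[k0 a0] phic phii Uo phiF] := pc.
have phi0 j : phi j (0, 0) = p by case: (phic j).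
have [e e0 He] := chart_capture2 Uo Up gc gp gF.
have [d d0 Hd] := chart_capture2 Uo Up hc hp hF.
exists (Num.min e d); first by rewrite lt_min e0.
move=> t s; rewrite !le_min => /andP[/He pt _] /andP[_ /Hd ps] gths.
have [_ [j _ [v hv vt]]] := path_component_end pt.
have v2 : v.2 = 0.
  have [[H _] _] := phiF j j (0, 0) v (half_box0 a0) hv.
  rewrite -vt -(phi0 j) in pt.
  by have [[_ <-]//|[_ ->]] := H pt.
have v1 : v.1 = 0.
  have [_ [H _]] := phiF j j (0, 0) v (half_box0 a0) hv.
  rewrite -gths -vt -(phi0 j) in ps.
  by have [[_ /= <-]//|[_ ->]//|[_ /= ? ?]|[_ /= ? ?]] := H ps; lra.
by rewrite -vt -(phi0 j); congr phi; case: v v1 v2 {hv vt} => x y /= -> ->.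
Qed.

(** If [K] met [Z] in an infinite set, the sets containing all but finitely many of these points
    would form a proper filter. At a cluster point, the complement of [V] belongs to it, a
    contradiction. *)
Lemma compact_locally_finite (T : topologicalType) (K Z : set T) : compact K ->
  (forall x, K x -> exists2 V, nbhs x V & finite_set (V `&` Z)) ->
  finite_set (K `&` Z).
Proof.
move=> cK H; apply: contrapT => Kinf.
pose G : set_system T := [set B | finite_set ((K `&` Z) `\` B)].
have GF : ProperFilter G.
  split; first by rewrite /G /= setD0.
  split; first by rewrite /G /= setDT; exact: finite_set0.
    by move=> P Q; rewrite /G /= setDIr finite_setU.
  by move=> P Q PQ; apply: sub_finite_set; exact: setDS.
have GK : G K.
  by rewrite /G /= (_ : _ `\` _ = set0) ?subset0 //; apply/seteqP; split=> // x [[]].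
have [x [Kx clx]] := cK G GF GK.
have [V Vx Vfin] := H x Kx.
have GV : G (~` V).
  rewrite /G /=; apply: sub_finite_set Vfin => y [[_ Zy]] /contrapT Vy //.
by have [y [nVy Vy]] := clx _ _ GV Vx.
Qed.

(** Crossings are counted as pairs of parameters in the compact unit square. They are isolated by
    [local_crossing], and pairs with different images have a neighbourhood without crossings because
    [S] is Hausdorff. *)
Lemma arcs_cross_finitely I J x x' y y' :
  (forall w, exists k a (phi : 'I_k -> R * R -> S), prong_chart Fs Fu w a phi) ->
  foliation R Fs -> foliation R Fu ->
  leaf_arc R Fs I x x' -> leaf_arc R Fu J y y' -> finite_set (I `&` J).
Proof.
move=> charts folS folU.
move=> /leaf_arcP[g [gc gi -> [gx gx'] gF]] /leaf_arcP[h [hc hi -> [hy hy'] hF]].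
pose K : set (R * R) := seg 0 1 `*` seg 0 1.
pose Z : set (R * R) := [set z | K z /\ g z.1 = h z.2].
suff fin : finite_set (K `&` Z).
  apply: sub_finite_set (finite_image (fun z => g z.1) fin).
  by move=> z [[t ht <-] [s hs hsg]]; exists (t, s).
apply: compact_locally_finite.
  by apply: compact_setX; exact: seg_compact.
move=> [t0 s0] [/= ht0 hs0]; case: (eqVneq (g t0) (h s0)) => [gh|gh]; last first.
  move: hausS; rewrite open_hausdorff => /(_ _ _ gh)[[A B] /=].
  rewrite !inE => -[At Bs] [oA oB /disjoints_subset AB].
  exists ((g @^-1` A) `*` (h @^-1` B)).
    exists (g @^-1` A, h @^-1` B) => //; split.
      by apply: gc; exact: open_nbhs_nbhs.
    by apply: hc; exact: open_nbhs_nbhs.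
  rewrite (_ : _ `&` _ = set0) //; apply/seteqP; split=> // -[t s].
  move=> [[/= At' Bs'] [_ /= gth]]; apply: (AB _ At').
  by rewrite gth.
have [_ Seq _] := folS; have [_ Ueq _] := folU.
have [k [a [phi pc]]] := charts (g t0).
have s01 : (0 : R) <= 1 by [].
have cl u : seg 0 1 (clamp (0:R) 1 u) by exact: clamp_seg.
have [||||||e e0 He] := @local_crossing _ _ _ _ (fun t => g (clamp 0 1 t))
    (fun s => h (clamp 0 1 s)) t0 s0 pc.
- by move=> t; apply: continuous_comp; [exact: clamp_continuous|exact: gc].
- by move=> t; apply: continuous_comp; [exact: clamp_continuous|exact: hc].
- by move=> t; rewrite (Seq _ _ (gF _ ht0)); exact: gF.
- by move=> t; rewrite gh (Ueq _ _ (hF _ hs0)); exact: hF.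
- by rewrite clampE.
- by rewrite clampE.
exists (ball (t0, s0) e); first exact: nbhsx_ballx.
apply: sub_finite_set (finite_set1 (t0, s0)) => -[t s] [[/= bt bs] [[/= ht hs] gth]].
have gt : g t = g t0.
  have := He t s; rewrite !clampE //; apply=> //.
    by rewrite distrC; apply: ltW bt.
  by rewrite distrC; apply: ltW bs.
by rewrite (gi _ _ ht ht0 gt) (hi _ _ hs hs0) // -gth gt gh.
Qed.

End ChartStars.

(** * Regular points of a prong chart *)

Section RegularPoints.
Variables (R : realType) (S : topologicalType) (Fs Fu : S -> set S).
Hypothesis hausS : hausdorff_space S.

Definition open_box (a : R) : set (R * R) :=
  [set v | (- a < v.1 < a) /\ (- a < v.2 < a)].
Definition closed_box (a : R) : set (R * R) :=
  [set v | (- a <= v.1 <= a) /\ (- a <= v.2 <= a)].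

Lemma closed_boxE (a : R) : closed_box a = seg (- a) a `*` seg (- a) a.
Proof. by apply/seteqP; split=> -[x y] []. Qed.

Lemma closed_box_compact (a : R) : compact (closed_box a).
Proof. by rewrite closed_boxE; apply: compact_setX; exact: seg_compact. Qed.

Lemma closed_half_boxE (a : R) : closed_half_box a = seg (- a) a `*` seg 0 a.
Proof. by apply/seteqP; split=> -[x y] []. Qed.

Lemma closed_half_box_compact (a : R) : compact (closed_half_box a : set (R * R)).
Proof. by rewrite closed_half_boxE; apply: compact_setX; exact: seg_compact. Qed.

Lemma open_box_closed a : open_box a `<=` closed_box a.
Proof. by move=> u; rewrite /open_box /closed_box /=; lra. Qed.

Lemma image_compact_closed (A K : set (R * R)) (phi : R * R -> S) : compact A ->
  {within A, continuous phi} -> closed K -> closed (phi @` (A `&` K)).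
Proof.
move=> cA phic cK; apply: compact_closed hausS _; apply: continuous_compact.
  by apply: continuous_subspaceW phic; exact: subIsetl.
exact: compact_closedI.
Qed.

(* A point of the path whose [q]-coordinate jumps between the finitely many
   allowed values would lie in two disjoint closed sets. *)
Lemma path_coordinate_constant (a : R) (Phi : R * R -> S) (q : R * R -> R)
    (A : set R) (L : set S) v w : continuous q ->
  {within closed_box a, continuous Phi} ->
  {in closed_box a &, injective Phi} -> finite_set A ->
  open_box a v -> open_box a w ->
  (forall u, open_box a u ->
     path_component R (L `&` (Phi @` open_box a)) (Phi v) (Phi u) -> A (q u)) ->
  path_component R (L `&` (Phi @` open_box a)) (Phi v) (Phi w) -> q v = q w.
Proof.
move=> qc Pc Pi Afin va wa HA /path_componentP[g [gc gA g0 g1]].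
have prefix (t : R) : 0 <= t -> path_component R (L `&` (Phi @` open_box a)) (Phi v) (g t).
  move=> t0; apply/path_componentP; exists (fun s : R => g (s * t)); split=> //.
  - move=> s; apply: (@continuous_comp _ _ _ (fun s : R => s * t) g); last exact: gc.
    by apply: cvgM; [exact: cvg_id|exact: cvg_cst].
  - by rewrite mul0r.
  - by rewrite mul1r.
pose C B : set S := Phi @` (closed_box a `&` q @^-1` B).
have C_closed (B : set R) : closed B -> closed (C B).
  move=> cB; apply: image_compact_closed => //; first exact: closed_box_compact.
  by apply: preimage_closed cB => z _; exact: qc.
apply: contrapT => qvw.
have [||||||t t01 []] := @seg_meets_closed R 0 1 (g @^-1` C [set q v])
    (g @^-1` C (A `\ q v)).
- apply: preim_closed => //; apply: C_closed.
  by apply: compact_closed; [exact: Rhausdorff|exact: compact_set1].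
- apply: preim_closed => //; apply: C_closed; apply: compact_closed; first exact: Rhausdorff.
  by apply: finite_compact; apply: sub_finite_set Afin; exact: subDsetl.
- exact: ler01.
- move=> t t01; have t0 : 0 <= t by case/andP: t01.
  have [_ [u ua ut]] := gA t.
  have Au : A (q u) by apply: HA => //; rewrite ut; exact: prefix.
  have [E|NE] := eqVneq (q u) (q v); [left|right]; exists u => //; split=> //.
  + exact: open_box_closed.
  + exact: open_box_closed.
  + by split=> //; exact/eqP.
- by exists v => //; split=> //; exact: open_box_closed.
- exists w => //; split; first exact: open_box_closed.
  split; last by move=> E; apply: qvw; rewrite E.
  by apply: HA => //; rewrite -g1; apply: prefix.
move=> [u [ua uq] ut] [u' [u'a [_ u'q]] u't].
by apply: u'q; rewrite -uq; congr q; apply: Pi; rewrite ?inE ?ut.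
Qed.

Lemma within_opp (A : set (R * R)) (Phi : R * R -> S) :
  {within -%R @` A, continuous Phi} -> {within A, continuous (Phi \o -%R)}.
Proof.
move=> /subspace_continuousP Pc; apply/subspace_continuousP => x Ax P PP.
have := Pc (- x) (imageP -%R Ax) P PP; rewrite !nbhs_simpl /= /within /=.
move=> /(@opp_continuous (R * R)%type x); rewrite /= nbhs_simpl /=.
by apply: filterS => y H Ay; apply: H; exists y.
Qed.

Lemma box_halves (a : R) (Phi : R * R -> S) :
  {within closed_half_box a, continuous Phi} ->
  {within closed_half_box a, continuous (Phi \o -%R)} ->
  {within closed_box a, continuous Phi}.
Proof.
move=> Pc PNc.
have cl := compact_closed (@norm_hausdorff _ _) (@closed_half_box_compact a).
have -> : closed_box a = closed_half_box a `|` -%R @` closed_half_box a.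
  apply/seteqP; split=> [u ua|u [|[v va <-]]].
  - case: (leP 0 u.2) => u2; [left|right; exists (- u); rewrite ?opprK //];
    by move: ua; rewrite /closed_box /closed_half_box /=; lra.
  - by rewrite /closed_box /closed_half_box /=; lra.
  - by move: va; rewrite /closed_box /closed_half_box /=; lra.
have E : -%R @` (-%R @` closed_half_box a) = closed_half_box a :> set (R * R).
  rewrite image_comp; apply/seteqP; split=> [_ [u ua <-]|u ua] /=; first by rewrite opprK.
  by exists u; rewrite /= ?opprK.
apply: withinU_continuous => //.
  apply: compact_closed; first exact: norm_hausdorff.
  apply: continuous_compact; last exact: closed_half_box_compact.
  by apply: continuous_subspaceT => x; exact: opp_continuous.
have := @within_opp (-%R @` closed_half_box a) (Phi \o -%R); rewrite E => /(_ PNc).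
by rewrite (_ : _ \o -%R = Phi) //; apply/funext => x; rewrite /= opprK.
Qed.

Lemma convex_itv (a x y s : R) : - a < x < a -> - a < y < a -> 0 <= s <= 1 ->
  - a < x + s * (y - x) < a.
Proof.
move=> hx hy /andP[s0 s1]; case: (leP x y) => xy.
  have : 0 <= s * (y - x) by apply: mulr_ge0; lra.
  have : 0 <= (1 - s) * (y - x) by apply: mulr_ge0; lra.
  by lra.
have : 0 <= s * (x - y) by apply: mulr_ge0; lra.
have : 0 <= (1 - s) * (x - y) by apply: mulr_ge0; lra.
by lra.
Qed.

Lemma box_horizontal_path (a : R) (Phi : R * R -> S) (L : set S) v w :
  {within closed_box a, continuous Phi} -> open_box a v -> open_box a w -> v.2 = w.2 ->
  (forall y, - a < y < a -> L (Phi (y, v.2))) ->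
  path_component R (L `&` (Phi @` open_box a)) (Phi v) (Phi w).
Proof.
move=> Pc va wa vw H; apply/path_componentP.
pose c (t : R) := v.1 + clamp 0 1 t * (w.1 - v.1).
have c_in t : - a < c t < a.
  by apply: convex_itv (clamp_seg t (@ler01 R)); [case: va|case: wa].
exists (fun t => Phi (c t, v.2)); split.
- apply: (within_comp (c := fun t => (c t, v.2)) Pc).
    apply: continuous_pair => t; last exact: cvg_cst.
    apply: cvgD; first exact: cvg_cst.
    by apply: cvgM; [exact: clamp_continuous|exact: cvg_cst].
  by move=> t; have := c_in t; move: va; rewrite /open_box /closed_box /=; lra.
- move=> t; split; first exact: H.
  by exists (c t, v.2) => //; have := c_in t; move: va; rewrite /open_box /=; lra.
- by rewrite /c clampE ?mul0r ?addr0; [case: v {va vw H c c_in}|seglra].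
- rewrite /c clampE; last by seglra.
  by rewrite mul1r addrC subrK vw; case: w {wa vw c c_in}.
Qed.

Lemma box_vertical_path (a : R) (Phi : R * R -> S) (L : set S) v w :
  {within closed_box a, continuous Phi} -> open_box a v -> open_box a w -> v.1 = w.1 ->
  (forall y, - a < y < a -> L (Phi (v.1, y))) ->
  path_component R (L `&` (Phi @` open_box a)) (Phi v) (Phi w).
Proof.
move=> Pc va wa vw H; apply/path_componentP.
pose c (t : R) := v.2 + clamp 0 1 t * (w.2 - v.2).
have c_in t : - a < c t < a.
  by apply: convex_itv (clamp_seg t (@ler01 R)); [case: va|case: wa].
exists (fun t => Phi (v.1, c t)); split.
- apply: (within_comp (c := fun t => (v.1, c t)) Pc).
    apply: continuous_pair => t; first exact: cvg_cst.
    apply: cvgD; first exact: cvg_cst.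
    by apply: cvgM; [exact: clamp_continuous|exact: cvg_cst].
  by move=> t; have := c_in t; move: va; rewrite /open_box /closed_box /=; lra.
- move=> t; split; first exact: H.
  by exists (v.1, c t) => //; have := c_in t; move: va; rewrite /open_box /=; lra.
- by rewrite /c clampE ?mul0r ?addr0; [case: v {va vw H c c_in}|seglra].
- rewrite /c clampE; last by seglra.
  by rewrite mul1r addrC subrK vw; case: w {wa vw c c_in}.
Qed.

(** Unfolds the two-prong model onto the plane. The second half plane is rotated by a half turn,
    which turns the gluing of [(- t, 0)] with [(t, 0)] into equality. *)
Definition side (i : 'I_2) (v : R * R) : R * R := if i == ord0 then v else - v.

Lemma ord2E (i : 'I_2) : i = ord0 \/ i = ord_max.
Proof. by case: i => -[|[|//]] h; [left|right]; exact/val_inj. Qed.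

Lemma ordS2 : (ordS (ord0 : 'I_2) = ord_max) * (ordS (ord_max : 'I_2) = ord0).
Proof. by split; exact/val_inj. Qed.

Lemma ord2_neq : ((ord0 : 'I_2) = ord_max) = False /\ ((ord_max : 'I_2) = ord0) = False.
Proof. by split; apply/propext; split. Qed.

Lemma pair_eqE (p q r s : R) : ((p, q) = (r, s)) = (p = r /\ q = s).
Proof. by apply/propext; split=> [[]|[-> ->]]. Qed.

Let ord2_simp := (ordS2, ord2_neq.1, ord2_neq.2, pair_eqE).

Lemma oppr_pair (p q : R) : - (p, q) = (- p, - q).
Proof. by []. Qed.

Lemma side_eq (a : R) (i j : 'I_2) u v : closed_half_box a u -> closed_half_box a v ->
  side i u = side j v <-> same_point i j u v.
Proof.
case: u v => [x y] [x' y']; rewrite /closed_half_box /same_point /glued /side /=.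
move=> hu hv; case: (ord2E i) => ->; case: (ord2E j) => ->;
  rewrite /= ?oppr_pair ?ord2_simp; split.
- by move=> [-> ->]; apply: Or41.
- by case=> [[]|[]|[]|[]] //; lra.
- move=> [xx yy]; case: (leP 0 x') => x0; [apply: Or43|apply: Or44]; split=> //; lra.
- by case=> [[]|[]|[]|[]] //; lra.
- move=> [xx yy]; case: (leP 0 x') => x0; [apply: Or43|apply: Or44]; split=> //; lra.
- by case=> [[]|[]|[]|[]] //; lra.
- by move=> [xx yy]; apply: Or41; split=> //; lra.
- by case=> [[]|[]|[]|[]] //; lra.
Qed.

Lemma side_horizontal (a : R) (i j : 'I_2) u v : half_box a u -> half_box a v ->
  (side i u).2 = (side j v).2 <-> same_horizontal i j u v.
Proof.
case: u v => [x y] [x' y']; rewrite /half_box /same_horizontal /side /=.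
move=> hu hv; case: (ord2E i) => ->; case: (ord2E j) => ->;
  rewrite /= ?ord2_simp; split.
- by move=> ->; left.
- by case=> [] [] //; lra.
- by move=> yy; right; lra.
- by case=> [] [] //; lra.
- by move=> yy; right; lra.
- by case=> [] [] //; lra.
- by move=> yy; left; split=> //; lra.
- by case=> [] [] //; lra.
Qed.

Lemma side_vertical (i j : 'I_2) u v :
  (side i u).1 = (side j v).1 <-> same_vertical i j u v.
Proof.
case: u v => [x y] [x' y']; rewrite /same_vertical /side /=.
case: (ord2E i) => ->; case: (ord2E j) => ->; rewrite /= ?ord2_simp; split.
- by move=> ->; apply: Or41.
- by case=> [[]|[]|[]|[]] //; lra.
- move=> xx; case: (ltrgtP x' 0) => x0; [apply: Or44|apply: Or43|apply: Or42];
    split=> //; lra.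
- by case=> [[]|[]|[]|[]] //; lra.
- move=> xx; case: (ltrgtP x' 0) => x0; [apply: Or44|apply: Or43|apply: Or42];
    split=> //; lra.
- by case=> [[]|[]|[]|[]] //; lra.
- by move=> xx; apply: Or41; split=> //; lra.
- by case=> [[]|[]|[]|[]] //; lra.
Qed.

Lemma side_box a i (u : R * R) : half_box a u -> open_box a (side i u).
Proof. by rewrite /half_box /open_box /side; case: (i == ord0) => /=; lra. Qed.

Lemma open_box_sides a (v : R * R) : open_box a v ->
  exists i u, half_box a u /\ side i u = v.
Proof.
case: v => x y va; case: (leP 0 y) => y0.
  by exists ord0, (x, y); split=> //; move: va; rewrite /half_box /open_box /=; lra.
exists ord_max, (- x, - y); rewrite /side /= oppr_pair !opprK; split=> //.
by move: va; rewrite /half_box /open_box /=; lra.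
Qed.

(** A plaque of a larger chart may cross a small box in several segments. Allowing finitely many
    values of the transverse coordinate is enough, since [path_coordinate_constant] shows that a
    path inside the box cannot switch between them. *)
Lemma box_chart a (Phi : R * R -> S) w : 0 < a ->
  {within closed_half_box a, continuous Phi} ->
  {within closed_half_box a, continuous (Phi \o -%R)} ->
  {in closed_box a &, injective Phi} -> Phi (0, 0) = w ->
  open (Phi @` open_box a) ->
  (forall v y, open_box a v -> - a < y < a ->
     Fs (Phi v) (Phi (y, v.2)) /\ Fu (Phi v) (Phi (v.1, y))) ->
  (forall v, open_box a v -> exists2 A : set R, finite_set A & forall u, open_box a u ->
     path_component R (Fs (Phi v) `&` (Phi @` open_box a)) (Phi v) (Phi u) -> A u.2) ->
  (forall v, open_box a v -> exists2 A : set R, finite_set A & forall u, open_box a u ->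
     path_component R (Fu (Phi v) `&` (Phi @` open_box a)) (Phi v) (Phi u) -> A u.1) ->
  exists phi : 'I_2 -> R * R -> S, prong_chart Fs Fu w a phi.
Proof.
move=> a0 Pc PNc Pi P0 Uo PF PS PU.
have Pcc := box_halves Pc PNc.
exists (fun i => Phi \o side i).
have UE : \bigcup_j ((Phi \o side j) @` half_box a) = Phi @` open_box a.
  apply/seteqP; split=> [_ [j _ [u ua <-]]|_ [v va <-]].
    by exists (side j u) => //; exact: side_box.
  by have [i [u [ua <-]]] := open_box_sides va; exists i => //; exists u.
rewrite /prong_chart UE; split=> //.
- move=> j; case: (ord2E j) => ->; split=> //=.
  by rewrite /side /= oppr_pair oppr0.
- move=> i j u v ua va; rewrite -(side_eq i j ua va) /=; split=> [|-> //].
  have cl l z : closed_half_box a z -> closed_box a (side l z).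
    by rewrite /closed_half_box /closed_box /side; case: (l == ord0) => /=; lra.
  by apply: Pi; rewrite inE; exact: cl.
- move=> i j u v ua va.
  have [ub vb] := (side_box i ua, side_box j va).
  rewrite -(side_horizontal i j ua va) -(side_vertical i j) /=; split; split.
  + have [A Afin HA] := PS _ ub.
    apply: (@path_coordinate_constant a Phi snd A) => // z; exact: cvg_snd.
  + move=> E; apply: box_horizontal_path => // y ya.
    by have [] := PF _ y ub ya.
  + have [A Afin HA] := PU _ ub.
    apply: (@path_coordinate_constant a Phi fst A) => // z; exact: cvg_fst.
  + move=> E; apply: box_vertical_path => // y ya.
    by have [] := PF _ y ub ya.
Qed.

End RegularPoints.

(** * Two-prong charts at the noncentral points of a prong chart *)

Section NoncentralRegular.
Variables (R : realType) (S : topologicalType) (Fs Fu : S -> set S).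
Hypothesis hausS : hausdorff_space S.
Variables (k : nat) (p : S) (a : R) (phi : 'I_k -> R * R -> S).
Hypothesis pc : prong_chart Fs Fu p a phi.

Lemma chart_continuous j : {within closed_half_box a, continuous (phi j)}.
Proof. by case: pc => _ H _ _ _; case: (H j). Qed.

Lemma chart_eq i j u v : closed_half_box a u -> closed_half_box a v ->
  phi i u = phi j v <-> same_point i j u v.
Proof. by case: pc => _ _ H _ _; exact: H. Qed.

Let U : set S := \bigcup_j (phi j @` half_box a).

Lemma chart_leaves i j u v : half_box a u -> half_box a v ->
  (path_component R (Fs (phi i u) `&` U) (phi i u) (phi j v) <-> same_horizontal i j u v) /\
  (path_component R (Fu (phi i u) `&` U) (phi i u) (phi j v) <-> same_vertical i j u v).
Proof. by case: pc => _ _ _ _ H; exact: H. Qed.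

Lemma path_componentS (L A B : set S) x y : A `<=` B ->
  path_component R (L `&` A) x y -> path_component R (L `&` B) x y.
Proof. by move=> AB; apply: path_component_subset; exact: setIS. Qed.

(** By saturation the union is [U] minus the images of the complements of the [O l] in the closed
    half boxes; these images are compact, hence closed. *)
Lemma chart_open (O : 'I_k -> set (R * R)) : (forall l, open (O l)) ->
  (forall i j u v, closed_half_box a u -> closed_half_box a v ->
     same_point i j u v -> O i u -> O j v) ->
  open (\bigcup_l (phi l @` (half_box a `&` O l))).
Proof.
move=> oO sat; pose K := \bigcup_l (phi l @` (closed_half_box a `&` ~` O l)).
have -> : \bigcup_l (phi l @` (half_box a `&` O l)) = U `&` ~` K.
  apply/seteqP; split=> [_ [l _ [u [ua Ou] <-]]|x [[l _ [u ua <-]] nK]].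
    split; first by exists l => //; exists u.
    move=> [l' _ [v [va nO] /(chart_eq _ _ va (half_box_closed ua)) vu]].
    have uv : same_point l l' u v.
      apply/chart_eq => //; first exact: half_box_closed.
      by symmetry; apply/chart_eq => //; exact: half_box_closed.
    by apply: nO; apply: sat uv Ou => //; exact: half_box_closed.
  exists l => //; exists u => //; split=> //; apply: contrapT => nO.
  by apply: nK; exists l => //; exists u => //; split=> //; exact: half_box_closed.
apply: openI; first by case: pc.
apply: closed_openC; apply: closed_bigcup; first exact: finite_finset.
move=> l _; apply: image_compact_closed => //.
- exact: closed_half_box_compact.
- exact: chart_continuous.
- exact: open_closedC.
Qed.

Lemma open_rectangle (a1 b1 a2 b2 : R) :
  open [set v : R * R | (a1 < v.1 < b1) /\ (a2 < v.2 < b2)].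
Proof.
have -> : [set v : R * R | (a1 < v.1 < b1) /\ (a2 < v.2 < b2)] =
    (fst @^-1` `]a1, b1[%classic) `&` (snd @^-1` `]a2, b2[%classic).
  by apply/seteqP; split=> v [h1 h2]; split; rewrite ?in_itv.
apply: openI.
  by apply: open_comp; [move=> z _; exact: cvg_fst|exact: interval_open].
by apply: open_comp; [move=> z _; exact: cvg_snd|exact: interval_open].
Qed.

Lemma open_when (T : topologicalType) (P : Prop) (A : set T) : open A ->
  open [set v | P /\ A v].
Proof.
move=> oA; have [HP|nP] := pselect P.
  by rewrite (_ : [set v | _] = A) //; apply/seteqP; split=> [v []|v Av].
by rewrite (_ : [set v | _] = set0); [exact: open0|apply/seteqP; split=> [v []|]].
Qed.

Lemma within_comp_sub (T V W : topologicalType) (A : set V) (B : set T) (g : V -> W)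
    (c : T -> V) : {within A, continuous g} -> continuous c ->
  (forall t, B t -> A (c t)) -> {within B, continuous (g \o c)}.
Proof.
move=> /subspace_continuousP gc cc BA; apply/subspace_continuousP => x Bx.
move=> P /(gc _ (BA _ Bx)) /=; rewrite /within /= !nbhs_simpl /= => /(cc x).
by rewrite /= !nbhs_simpl /=; apply: filterS => t H Bt; apply: H; exact: BA.
Qed.

Lemma translation_continuous (u : R * R) : continuous (fun v : R * R => u + v).
Proof. by move=> v; apply: cvgD; [exact: cvg_cst|exact: cvg_id]. Qed.

Lemma interior_regular j u : half_box a u -> 0 < u.2 ->
  exists b (psi : 'I_2 -> R * R -> S), prong_chart Fs Fu (phi j u) b psi.
Proof.
case: u => [x y] ua /= y0.
have [b [b0 bx1 bx2 by1 by2]] : exists b : R, [/\ 0 < b, - a < x - b, x + b < a,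
    0 < y - b & y + b < a].
  pose m := Num.min (Num.min (a - x) (a + x)) (Num.min (a - y) y).
  have m0 : 0 < m by rewrite !lt_min; move: ua; rewrite /half_box /= => -[] *; lra.
  have [m1 m2 m3 m4] : [/\ m <= a - x, m <= a + x, m <= a - y & m <= y].
    by rewrite /m !ge_min !lexx ?orbT.
  by exists (m / 2); split; lra.
have PE v : (x, y) + v = (x + v.1, y + v.2) by case: v.
have in_half v : open_box b v -> half_box a ((x, y) + v).
  by rewrite PE /open_box /half_box /=; lra.
have in_closed v : closed_box b v -> closed_half_box a ((x, y) + v).
  by rewrite PE /closed_box /closed_half_box /=; lra.
have sub : (phi j \o (fun v => (x, y) + v)) @` open_box b `<=` U.
  by move=> _ [v vb <-]; exists j => //; exists ((x, y) + v) => //; exact: in_half.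
exists b; apply: (@box_chart _ _ _ _ hausS b (phi j \o (fun v => (x, y) + v))) => //.
- apply: (within_comp_sub (@chart_continuous j) (@translation_continuous (x, y))) => v vb.
  by apply: in_closed; move: vb; rewrite /closed_box /closed_half_box /=; lra.
- rewrite -[_ \o -%R]/(phi j \o (fun v => (x, y) - v)).
  apply: (within_comp_sub (@chart_continuous j)).
    by move=> v; apply: cvgB; [exact: cvg_cst|exact: cvg_id].
  move=> v vb; apply: in_closed; move: vb.
  by rewrite /closed_box /closed_half_box /=; lra.
- move=> v w; rewrite !inE => vb wb /= /(chart_eq _ _ (in_closed _ vb) (in_closed _ wb)).
  rewrite /same_point /glued !PE /=; move: vb wb; rewrite /closed_box /=.
  move=> vb wb [[_ []]|[[_ ?] _]|[_ ? _ _ _]|[_ ? _ _ _]]; [|by exfalso; lra..].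
  by case: v w {vb wb} => [v1 v2] [w1 w2] /= /addrI -> /addrI ->.
- by rewrite /= addr0.
- rewrite (_ : _ @` _ = \bigcup_l (phi l @` (half_box a `&`
      [set v | l = j /\ ((x - b < v.1 < x + b) /\ (y - b < v.2 < y + b))]))).
    apply: chart_open => [l|l l' u v ua' va'].
      by apply: open_when; exact: open_rectangle.
    rewrite /same_point /glued /= => -[[-> ->]//|[-> ->]|[]|[]] /= *; exfalso; lra.
  apply/seteqP; split=> [_ [v vb <-]|_ [l _ [v [va [-> vb]] <-]]].
    exists j => //; exists ((x, y) + v) => //; split; first exact: in_half.
    by split=> //; rewrite PE /=; move: vb; rewrite /open_box /=; lra.
  exists (v.1 - x, v.2 - y); first by move: vb; rewrite /open_box /=; lra.
  by congr (phi j _); rewrite PE /= !(addrC _ (- _)) !addrA; case: v {va vb} => *;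
    rewrite !subrr !add0r.
- move=> v t vb tb /=.
  have tb1 : half_box a ((x, y) + (t, v.2)).
    by apply: in_half; move: vb tb; rewrite /open_box /=; lra.
  have tb2 : half_box a ((x, y) + (v.1, t)).
    by apply: in_half; move: vb tb; rewrite /open_box /=; lra.
  have [[_ H] _] := chart_leaves j j (in_half _ vb) tb1.
  have [_ [_ H']] := chart_leaves j j (in_half _ vb) tb2.
  split.
    by have /path_component_end[] := H (or_introl (conj erefl erefl)).
  by have /path_component_end[] := H' (Or41 _ _ _ (conj erefl erefl)).
- move=> v vb; exists [set v.2]; first exact: finite_set1.
  move=> w wb /(path_componentS sub).
  have [[H _] _] := chart_leaves j j (in_half _ vb) (in_half _ wb).
  move=> /H[[_]|[]]; rewrite !PE /=; first by move/addrI.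
  by move: vb; rewrite /open_box /=; lra.
(* The second value is the mirror image of the vertical line. At a spine the adjacent half plane is
   the same one, so the leaf may come back through the box there. *)
- move=> v vb; exists ([set v.1] `|` [set - x - (x + v.1)]).
    by rewrite finite_setU; split; exact: finite_set1.
  move=> w wb /(path_componentS sub).
  have [_ [H _]] := chart_leaves j j (in_half _ vb) (in_half _ wb).
  move=> /H[[_]|[]|[_ _]|[_ _]]; rewrite !PE /=.
  + by move/addrI ->; left.
  + by move=> ? ?; left; lra.
  + by move=> ?; right; lra.
  + by move=> ?; right; lra.
Qed.

Lemma addr_pair (q r s t : R) : (q, r) + (s, t) = (q + s, r + t).
Proof. by []. Qed.

(** The box around a point of a prong takes its upper half from sector [j] and its lower half,
    rotated by a half turn, from the preceding sector [i]. *)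
Lemma boundary_regular j x : 0 < x -> x < a ->
  exists b (psi : 'I_2 -> R * R -> S), prong_chart Fs Fu (phi j (x, 0)) b psi.
Proof.
move=> x0 xa; pose i := ord_pred j; have ji : j = ordS i by rewrite ord_predK.
have [b [b0 bx1 bx2]] : exists b : R, [/\ 0 < b, 0 < x - b & x + b < a].
  pose m := Num.min (a - x) x.
  have m0 : 0 < m by rewrite !lt_min; lra.
  have [m1 m2] : m <= a - x /\ m <= x by rewrite /m !ge_min !lexx ?orbT.
  by exists (m / 2); split; lra.
pose Phi (v : R * R) : S :=
  if 0 <= v.2 then phi j (x + v.1, v.2) else phi i (- (x + v.1), - v.2).
have glue (s : R) : 0 <= s -> s <= a -> phi i (- s, 0) = phi j (s, 0).
  move=> s0 sa; apply/chart_eq; [by boxlra|by boxlra|].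
  by apply: Or43; split.
pose sec (v : R * R) := if 0 <= v.2 then j else i.
pose loc (v : R * R) := if 0 <= v.2 then (x + v.1, v.2) else (- (x + v.1), - v.2).
have PhiE v : Phi v = phi (sec v) (loc v).
  by rewrite /Phi /sec /loc; case: (0 <= v.2).
have in_half v : open_box b v -> half_box a (loc v).
  by rewrite /loc /open_box /half_box; case: (leP 0 v.2) => ? /=; lra.
have in_closed v : closed_box b v -> closed_half_box a (loc v).
  by rewrite /loc /closed_box /closed_half_box; case: (leP 0 v.2) => ? /=; lra.
have sub : Phi @` open_box b `<=` U.
  by move=> _ [v vb <-]; rewrite PhiE; exists (sec v) => //; exists (loc v) => //; exact: in_half.
have within_eq (f g : R * R -> S) (A : set (R * R)) :
    (forall v, A v -> f v = g v) -> {within A, continuous f} -> {within A, continuous g}.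
  by move=> fg; apply: subspace_eq_continuous => v; rewrite inE; exact: fg.
exists b; apply: (@box_chart _ _ _ _ hausS b Phi) => //.
- apply: (within_eq (phi j \o (fun v => (x, 0) + v))).
    case=> v1 v2; rewrite /Phi /closed_half_box /= => -[_ /andP[-> _]].
    by congr (phi j _); rewrite addr_pair add0r.
  apply: (within_comp_sub (@chart_continuous j) (@translation_continuous (x, 0))) => -[v1 v2].
  by rewrite addr_pair add0r /closed_half_box /=; lra.
- apply: (within_eq (phi i \o (fun v => (- x, 0) + v))).
    case=> v1 v2; rewrite /Phi /closed_half_box /= => -[hv1 hv2].
    (* On the axis [Phi] is defined through sector [j]; [glue] rewrites it there in sector [i]. *)
    case: (leP 0 (- v2)) => v20.
      have -> : v2 = 0 by lra.
      rewrite oppr0 -glue; [|lra|lra]; congr (phi i _).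
      by rewrite addr_pair add0r; congr pair; lra.
    by congr (phi i _); rewrite addr_pair; congr pair; lra.
  apply: (within_comp_sub (@chart_continuous i) (@translation_continuous (- x, 0))) => -[v1 v2].
  by rewrite addr_pair add0r /closed_half_box /=; lra.
- move=> v w; rewrite !inE => vb wb.
  rewrite !PhiE => /(chart_eq _ _ (in_closed _ vb) (in_closed _ wb)).
  rewrite /same_point /glued /sec /loc; move: vb wb; rewrite /closed_box.
  case: v w => [v1 v2] [w1 w2] /=.
  case: (leP 0 v2) => v20; case: (leP 0 w2) => w20 /= vb wb;
    move=> [[_ []]|[[? ?] _]|[_ ? ? ? ?]|[_ ? ? ? ?]] *; try (exfalso; lra);
    congr pair; lra.
- by rewrite /Phi /= lexx addr0.
(* Full rectangles across the axis are open, and the half box cuts them down to the two halves. The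
   gluing matches their edges, which is the saturation required. *)
- rewrite (_ : _ @` _ = \bigcup_l (phi l @` (half_box a `&`
      ([set v | l = j /\ ((x - b < v.1 < x + b) /\ (- b < v.2 < b))] `|`
       [set v | l = i /\ ((- x - b < v.1 < - x + b) /\ (- b < v.2 < b))])))).
    apply: chart_open => [l|l l' u v ua' va'].
      by apply: openU; apply: open_when; exact: open_rectangle.
    rewrite /same_point /glued /= => -[[-> ->]//|[-> ->]|[ll u2 v2 v1 u1]|[ll v2 u2 u1 v1]] /=.
    + by case=> -[_ /= ?]; exfalso; lra.
    + case=> -[lE /= ?]; first by exfalso; lra.
      by left; rewrite ll lE -ji; split=> //; lra.
    + case=> -[lE /= ?]; last by exfalso; lra.
      right; split; last by lra.
      by apply: ordS_inj; rewrite -ll lE.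
  apply/seteqP; split=> [_ [v vb <-]|_ [l _ [[v1 v2] [va Ov] <-]]].
    rewrite PhiE; exists (sec v) => //; exists (loc v) => //; split; first exact: in_half.
    move: vb; rewrite /sec /loc /open_box; case: (leP 0 v.2) => ? /= ?.
      by left; split=> //; lra.
    by right; split=> //; lra.
  case: Ov => -[-> /= vb].
    exists (v1 - x, v2); first by move: vb; rewrite /open_box /=; lra.
    rewrite /Phi /=; have -> : 0 <= v2 by move: va; rewrite /half_box /=; lra.
    by congr (phi j _); congr pair; lra.
  exists (- v1 - x, - v2); first by move: vb; rewrite /open_box /=; lra.
  rewrite /Phi /=; case: (leP 0 (- v2)) => v20.
    have v2E : v2 = 0 by move: va; rewrite /half_box /=; lra.
    rewrite v2E oppr0 -glue; [|lra|lra].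
    by congr (phi i _); congr pair; lra.
  by congr (phi i _); congr pair; lra.
- move=> v t vb tb; rewrite !PhiE.
  have tb1 : half_box a (loc (t, v.2)).
    by apply: in_half; move: vb tb; rewrite /open_box /=; lra.
  have tb2 : half_box a (loc (v.1, t)).
    by apply: in_half; move: vb tb; rewrite /open_box /=; lra.
  have [[_ H] _] := chart_leaves (sec v) (sec (t, v.2)) (in_half _ vb) tb1.
  have [_ [_ H']] := chart_leaves (sec v) (sec (v.1, t)) (in_half _ vb) tb2.
  split.
    suff /H/path_component_end[] :
      same_horizontal (sec v) (sec (t, v.2)) (loc v) (loc (t, v.2)) by [].
    by left; rewrite /sec /loc /=; case: (0 <= v.2).
  suff /H'/path_component_end[] :
    same_vertical (sec v) (sec (v.1, t)) (loc v) (loc (v.1, t)) by [].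
  move: vb; rewrite /same_vertical /sec /loc /open_box.
  case: (leP 0 v.2) => v20; case: (leP 0 t) => t0 /= vb.
  + exact: Or41.
  + by apply: Or44; split=> //; lra.
  + by apply: Or43; split=> //; lra.
  + exact: Or41.
(* At a spine both halves come from one sector, where the heights [v.2] and [- v.2] of the box lie
   on the same horizontal. *)
- move=> v vb; exists ([set v.2] `|` [set - v.2]).
    by rewrite finite_setU; split; exact: finite_set1.
  move=> w wb /(path_componentS sub); rewrite !PhiE.
  have [[H _] _] := chart_leaves (sec v) (sec w) (in_half _ vb) (in_half _ wb).
  move=> /H; rewrite /same_horizontal /loc.
  case: (leP 0 v.2) => v20; case: (leP 0 w.2) => w20 /= [[_ ?]|[? ?]];
    by [left; lra|right; lra].
- move=> v vb; exists ([set v.1] `|` [set - x - (x + v.1)]).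
    by rewrite finite_setU; split; exact: finite_set1.
  move=> w wb /(path_componentS sub); rewrite !PhiE.
  have [_ [H _]] := chart_leaves (sec v) (sec w) (in_half _ vb) (in_half _ wb).
  move=> /H; rewrite /same_vertical /loc; move: vb wb; rewrite /open_box.
  case: (leP 0 v.2) => v20; case: (leP 0 w.2) => w20 /= ? ? [[_ ?]|[? ?]|[_ ? ?]|[_ ? ?]];
    by [left; lra|right; lra].
Qed.

Lemma noncentral_regular j u : half_box a u -> u <> (0, 0) ->
  exists b (psi : 'I_2 -> R * R -> S), prong_chart Fs Fu (phi j u) b psi.
Proof.
case: u => x y ua u0; case: (ltP 0 y) => y0; first exact: interior_regular.
have yE : y = 0 by move: ua; boxlra.
rewrite yE in ua u0 *; case: (ltrgtP x 0) => x0; last by rewrite x0 in u0.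
  have -> : phi j (x, 0) = phi (ordS j) (- x, 0).
    apply/chart_eq; [by move: ua; boxlra|by move: ua; boxlra|].
    by apply: Or43; split=> //=; rewrite ?opprK //; lra.
  by apply: boundary_regular; move: ua; boxlra.
by apply: boundary_regular; move: ua; boxlra.
Qed.

End NoncentralRegular.

(** * First intersection points *)

Section Homeomorphisms.
Variables (R : realType) (S : topologicalType) (f g : S -> S).
Hypotheses (fc : continuous f) (gc : continuous g) (fK : cancel f g) (gK : cancel g f).

Lemma image_cancel (B : set S) : f @` B = g @^-1` B.
Proof.
apply/seteqP; split=> [_ [x Bx <-]|y By]; first by rewrite /preimage /= fK.
by exists (g y).
Qed.

Lemma homeo_open (B : set S) : open B -> open (f @` B).
Proof. by rewrite image_cancel => oB; apply: open_comp => // x _; exact: gc. Qed.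

End Homeomorphisms.

Section FoliatedHomeomorphisms.
Variables (R : realType) (S : topologicalType).
Implicit Types (f g : S -> S).

Lemma path_component_image f (B : set S) x y : continuous f ->
  path_component R B x y -> path_component R (f @` B) (f x) (f y).
Proof.
move=> fc /path_componentP[h [hc hB <- <-]]; apply/path_componentP; exists (f \o h).
split=> //; last by move=> t; exists (h t).
by move=> t; apply: continuous_comp; [exact: hc|exact: fc].
Qed.

Lemma path_component_homeo f g (B : set S) x y : continuous f -> continuous g ->
  cancel f g -> path_component R (f @` B) (f x) (f y) <-> path_component R B x y.
Proof.
move=> fc gc fK; split; last exact: path_component_image.
move/(path_component_image gc); rewrite image_comp !fK.
by rewrite (_ : g \o f = id) ?image_id //; apply/funext => z; exact: fK.
Qed.

(** Charts are defined by topology and leaves alone, so a homeomorphism preserving both foliations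
    transports them; this makes the singular set invariant. *)
Lemma prong_chart_homeo Fs Fu f g k p a (phi : 'I_k -> R * R -> S) :
  continuous f -> continuous g -> cancel f g -> cancel g f ->
  (forall x, f @` Fs x = Fs (f x)) -> (forall x, f @` Fu x = Fu (f x)) ->
  prong_chart Fs Fu p a phi -> prong_chart Fs Fu (f p) a (fun j => f \o phi j).
Proof.
move=> fc gc fK gK fS fU [k0 phic phii Uo phiF].
have UE : \bigcup_j ((f \o phi j) @` half_box a) = f @` (\bigcup_j (phi j @` half_box a)).
  by rewrite image_bigcup; apply: eq_bigcupr => j _; rewrite image_comp.
rewrite /prong_chart UE; split=> //.
- move=> j; have [pc p0] := phic j; split; last by rewrite /= p0.
  by apply: within_continuous_comp => // y _; exact: fc.
- move=> i j u v ua va; rewrite -phii //=; split=> [/(can_inj fK)//|-> //].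
- by apply: (homeo_open gc fK gK).
- move=> i j u v ua va; have [H H'] := phiF i j u v ua va.
  rewrite /= -fS -fU !(image_cancel fK gK) -!preimage_setI -!(image_cancel fK gK); split.
    by rewrite (path_component_homeo _ _ _ fc gc fK).
  by rewrite (path_component_homeo _ _ _ fc gc fK).
Qed.

Lemma singularities_homeo Fs Fu f g : continuous f -> continuous g ->
  cancel f g -> cancel g f ->
  (forall x, f @` Fs x = Fs (f x)) -> (forall x, f @` Fu x = Fu (f x)) ->
  forall x, singularities R Fs Fu (f x) <-> singularities R Fs Fu x.
Proof.
move=> fc gc fK gK fS fU.
have inv F : (forall x, f @` F x = F (f x)) -> forall x, g @` F x = F (g x).
  move=> fF x; rewrite -{1}(gK x) -fF image_comp.
  by rewrite (_ : g \o f = id) ?image_id //; apply/funext => z; exact: fK.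
move=> x; split=> H [a [phi pc]]; apply: H.
  by exists a, (fun j => f \o phi j); apply: (prong_chart_homeo fc gc fK gK).
exists a, (fun j => g \o phi j); rewrite -[x]fK.
by apply: (prong_chart_homeo gc fc gK fK) => //; exact: inv.
Qed.

Lemma singularities_finite Fs Fu : hausdorff_space S -> compact [set: S] ->
  (forall w, exists k a (phi : 'I_k -> R * R -> S), prong_chart Fs Fu w a phi) ->
  finite_set (singularities R Fs Fu).
Proof.
move=> hausS cS charts; rewrite -[X in finite_set X]setTI.
apply: compact_locally_finite cS _ => p _.
have [k [a [phi pc]]] := charts p.
exists (\bigcup_j (phi j @` half_box a)).
  apply: open_nbhs_nbhs; split; last exact: prong_chart_center pc.
  by case: pc.
apply: sub_finite_set (finite_set1 p) => _ [[j _ [u ua <-]] sing].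
have [->|u0] := pselect (u = (0, 0)); first by case: pc => _ /(_ j)[].
by case: sing; have [b [psi ?]] := noncentral_regular hausS pc j ua u0; exists b, psi.
Qed.

End FoliatedHomeomorphisms.

Section FirstIntersections.
Variables (R : realType) (S : topologicalType) (A : set (chart R S)).
Variables (f : S -> S) (Fs Fu : S -> set S) (mus muu : set S -> R) (lambda : R).
Variable Sg : set S.
Hypothesis hS : closed_oriented_surface A.
Hypothesis hf : generalized_pseudo_anosov A f Fs Fu mus muu lambda.
Hypothesis hSg : is_Sing R f Fs Fu Sg.

Lemma Sing_finite_invariant : finite_set Sg /\ singularities R Fs Fu `<=` Sg /\
  forall x, Sg (f x) <-> Sg x.
Proof.
have [hausS cS _ _ _] := hS.
have [[[fc [g [gc fK gK]]] _] [_ _ _ _ charts] _ fF _] := hf.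
have fS x : f @` Fs x = Fs (f x) by case: (fF x).
have fU x : f @` Fu x = Fu (f x) by case: (fF x).
have Sing_fin : finite_set (singularities R Fs Fu).
  apply: singularities_finite => // w.
  by have [k [a [phi []]]] := charts w; exists k, a, phi.
have Sing_f := singularities_homeo R fc gc fK gK fS fU.
have [H1 H2] := hSg.
have [ne|/set0P/negP/negPn/eqP e0] := pselect (singularities R Fs Fu !=set0).
  by rewrite (H1 ne); split=> //; split.
have [_ Sfin fSg _] := H2 e0; split=> //; split; first by rewrite e0.
move=> x; split=> [|Sx]; last by rewrite -fSg; exists x.
by rewrite -{1}fSg => -[y Sy /(can_inj fK) <-].
Qed.

Lemma first_intersection_orbits : exists E, finite_set E /\
  forall z, first_intersection R Fs Fu Sg z ->
    exists a b y, E y /\ iter a f z = iter b f y.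
Proof.
have [hausS cS _ _ _] := hS.
have [[[fc [g [gc fK gK]]] _] [folS folU addU addS charts] l1 fF [fmU fmS]] := hf.
have fS x : f @` Fs x = Fs (f x) by case: (fF x).
have fU x : f @` Fu x = Fu (f x) by case: (fF x).
have pcharts w : exists k a (phi : 'I_k -> R * R -> S), prong_chart Fs Fu w a phi.
  by have [k [a [phi []]]] := charts w; exists k, a, phi.
have fi : injective f := can_inj fK.
have gi : injective g := can_inj gK.
have [Sg_fin [SgSing SgE]] := Sing_finite_invariant.
have SgG x : Sg x -> Sg (g x) by rewrite -{1}[x]gK => /SgE.
have leaf_f F : (forall x, f @` F x = F (f x)) -> forall x y, F x y -> F (f x) (f y).
  by move=> H x y Fxy; rewrite -H; exists y.
have leaf_g F : (forall x, f @` F x = F (f x)) -> forall x y, F x y -> F (g x) (g y).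
  by move=> H x y; rewrite -{1}[x]gK -H => -[z Fz <-]; rewrite fK.
have l0 : 0 < lambda by lra.
have li0 : 0 < lambda^-1 by rewrite invr_gt0.
have li1 : lambda^-1 < 1 by rewrite invf_lt1.
have gmU J : interval_of R Fu J -> mus (g @` J) = lambda^-1 * mus J.
  move=> [x [y Jxy]].
  have : mus (f @` (g @` J)) = lambda * mus (g @` J).
    apply: fmU; exists (g x), (g y); apply: leaf_arc_image Jxy => //; exact: leaf_g.
  rewrite image_comp (_ : f \o g = id) ?image_id; last by apply/funext => z; exact: gK.
  by move=> ->; rewrite mulrA mulVf ?mul1r // gt_eqF.
have /choice[ch chP] : forall w, exists c : {k : nat & (R * ('I_k -> R * R -> S))%type},
    normalized_chart Fs Fu mus muu w (projT2 c).1 (projT2 c).2.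
  move=> w; have [k [a [phi H]]] := charts w.
  by exists (existT (fun k => (R * ('I_k -> R * R -> S))%type) k (a, phi)).
have starS w := normalized_horizontal_star (chP w).
have starU w := normalized_vertical_star (chP w).
have reg w : ~ Sg w -> exists a (phi : 'I_2 -> R * R -> S), prong_chart Fs Fu w a phi.
  by move=> nSw; apply: contrapT => no; apply: nSw; apply: SgSing.
have regS w : ~ Sg w -> exists a (pr : 'I_2 -> R -> S), star (Fs w) w a pr.
  by move=> /reg[a [phi /horizontal_star st]]; exists a; eexists; exact: st.
have regU w : ~ Sg w -> exists a (pr : 'I_2 -> R -> S), star (Fu w) w a pr.
  by move=> /reg[a [phi /vertical_star st]]; exists a; eexists; exact: st.
have [labs labsP] := ex_classifies hausS folS addS starS Sg_fin regS fc fi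
  (leaf_f _ fS) (fun x => (SgE x).2) li0 li1 fmS.
(* Unstable arcs are stretched by [f], so the inverse [g] plays the contraction that rules out
   saddle connections. *)
have [labu labuP] := ex_classifies hausS folU addU starU Sg_fin regU gc gi
  (leaf_g _ fU) SgG li0 li1 gmU.
have contr : leaf_contraction Fs Fu Sg muu f lambda^-1.
  by split=> //; [exact: leaf_f|exact: leaf_f].
have [E [Efin HE]] := finite_orbits Sg_fin labsP labuP
  (leaf_arc_len_gt0 hausS folS addS starS)
  (leaf_arc_len_sub hausS folS addS starS)
  (fun I J p q x y => @arcs_cross_finitely _ _ _ _ hausS I J p x q y pcharts folS folU) contr.
exists E; split=> // z [nSz [p [q [Cs [Cu [I [J [[Sp Sq] _ _ [Iz Jz] IJ]]]]]]]].
by apply: (HE I J p q).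
Qed.

End FirstIntersections.

(** * Equivariance and counting *)

Section Equivariance.
Variables (R : realType) (S : topologicalType) (Fs Fu : S -> set S) (f g : S -> S).
Variable Sg : set S.
Hypotheses (fc : continuous f) (gc : continuous g) (fK : cancel f g) (gK : cancel g f).
Hypothesis fS : forall x, f @` Fs x = Fs (f x).
Hypothesis fU : forall x, f @` Fu x = Fu (f x).
Hypothesis fSg : forall x, Sg (f x) <-> Sg x.

(** The properties shared by [f] and its inverse. An inclusion proved for every symmetry, applied to
    both, becomes an equality. *)
Definition symmetry (h : S -> S) :=
  [/\ continuous h, injective h, forall x y, Fs x y -> Fs (h x) (h y),
      forall x y, Fu x y -> Fu (h x) (h y) & forall x, Sg x -> Sg (h x)].

Lemma symmetry_f : symmetry f.
Proof.
split=> //; first exact: can_inj fK.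
- by move=> x y xy; rewrite -fS; exists y.
- by move=> x y xy; rewrite -fU; exists y.
- by move=> x /fSg.
Qed.

Lemma symmetry_g : symmetry g.
Proof.
split=> //; first exact: can_inj gK.
- by move=> x y; rewrite -{1}[x]gK -fS => -[z ? <-]; rewrite fK.
- by move=> x y; rewrite -{1}[x]gK -fU => -[z ? <-]; rewrite fK.
- by move=> x Sx; apply/fSg; rewrite gK.
Qed.

Lemma image_fg (B : set S) : f @` (g @` B) = B.
Proof. by rewrite image_comp (_ : f \o g = id) ?image_id //; apply/funext => x; exact: gK. Qed.

Lemma image_gf (B : set S) : g @` (f @` B) = B.
Proof. by rewrite image_comp (_ : g \o f = id) ?image_id //; apply/funext => x; exact: fK. Qed.

Lemma image_eq (B C : set S) : f @` B `<=` C -> g @` C `<=` B -> C = f @` B.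
Proof.
move=> BC CB; apply/seteqP; split=> // x Cx.
by exists (g x); rewrite ?gK //; apply: CB; exists x.
Qed.

Lemma image_f_setC (B : set S) : f @` (~` B) = ~` (f @` B).
Proof. by rewrite !(image_cancel fK gK). Qed.

Lemma image_f_setI (B C : set S) : f @` (B `&` C) = f @` B `&` f @` C.
Proof. by rewrite !(image_cancel fK gK). Qed.

Lemma Ju_sub h z : symmetry h -> h @` Ju R Fu Sg z `<=` Ju R Fu Sg (h z).
Proof.
move=> [hc hi _ hu hSg] _ [x [J [q Sq Jq] Jx] <-].
exists (h @` J); last by exists x.
by exists (h q); [exact: hSg|exact: leaf_arc_image].
Qed.

Lemma calJu_sub h z : symmetry h -> (forall x, h (f x) = f (h x)) ->
  h @` calJu R Fu f Sg z `<=` calJu R Fu f Sg (h z).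
Proof.
move=> hs hf _ [x [i _ xi] <-]; exists i => //=.
have -> : iter i f (h x) = h (iter i f x) by elim: (i) => //= m ->; rewrite hf.
by apply: Ju_sub => //; exists (iter i f x).
Qed.

Lemma calJu_f z : calJu R Fu f Sg (f z) = f @` calJu R Fu f Sg z.
Proof.
apply: image_eq; first by apply: calJu_sub => //; exact: symmetry_f.
rewrite -{2}[z]fK; apply: calJu_sub; first exact: symmetry_g.
by move=> x; rewrite fK gK.
Qed.

Lemma segments_sub F h B I : continuous h -> injective h ->
  (forall x y, F x y -> F (h x) (h y)) -> (forall x, Sg x -> Sg (h x)) ->
  segments_to R Sg F B I -> segments_to R Sg F (h @` B) (h @` I).
Proof.
move=> hc hi hF hSg [p [x [Sp Bx pIx IB]]]; exists (h p), (h x); split.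
- exact: hSg.
- by exists x.
- exact: leaf_arc_image.
apply/seteqP; split=> // _ [[[y Iy <-] nyp] [y' By' /hi yy]].
suff : ((I `\` [set p; x]) `&` B) y by rewrite IB.
split; last by rewrite -yy.
split=> // -[yp|yx]; apply: nyp; [left|right].
  by rewrite yp.
by rewrite yx.
Qed.

Lemma segments_f F B : (forall x y, F x y -> F (f x) (f y)) ->
  (forall x y, F x y -> F (g x) (g y)) ->
  cup (segments_to R Sg F (f @` B)) = f @` cup (segments_to R Sg F B).
Proof.
have [_ fi _ _ fSg'] := symmetry_f; have [_ gi _ _ gSg'] := symmetry_g.
move=> fF gF; apply: image_eq => _ [x [I segI Ix] <-].
  by exists (f @` I); [exact: segments_sub|exists x].
exists (g @` I); last by exists x.
by have := segments_sub gc gi gF gSg' segI; rewrite image_gf.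
Qed.

Lemma delta_s_f z :
  cup (delta_s R Fs Fu f Sg (f z)) = f @` cup (delta_s R Fs Fu f Sg z).
Proof.
have [_ _ fFs _ _] := symmetry_f; have [_ _ gFs _ _] := symmetry_g.
by rewrite /delta_s calJu_f segments_f.
Qed.

Lemma delta_u_f z :
  cup (delta_u R Fs Fu f Sg (f z)) = f @` cup (delta_u R Fs Fu f Sg z).
Proof.
have [_ _ _ fFu _] := symmetry_f; have [_ _ _ gFu _] := symmetry_g.
by rewrite /delta_u delta_s_f segments_f.
Qed.

Lemma cup_delta_u_iter n z :
  cup (delta_u_iter R Fs Fu f Sg n z) = iter n f @` cup (delta_u R Fs Fu f Sg z).
Proof.
apply/seteqP; split=> [_ [_ [I dI <-] [y Iy <-]]|_ [y [I dI Iy] <-]].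
  by exists y => //; exists I.
by exists (iter n f @` I); [exists I|exists y].
Qed.

Definition partition_interior n z : set S :=
  ~` (cup (delta_s R Fs Fu f Sg z) `|` cup (delta_u_iter R Fs Fu f Sg n z)).

(** The graphs are built from leaves, [Sg] and [f], all of which [f] preserves; the order [n] is
    unaffected because [f] commutes with its own iterates. *)
Lemma partition_interior_f n z :
  partition_interior n (f z) = f @` partition_interior n z.
Proof.
rewrite /partition_interior image_f_setC image_setU !cup_delta_u_iter.
rewrite delta_s_f delta_u_f !image_comp; congr (~` (_ `|` _ @` _)).
by apply/funext => x /=; rewrite -iterSr.
Qed.

Lemma connected_component_image (h : S -> S) (O : set S) x : continuous h ->
  h @` connected_component O x `<=` connected_component (h @` O) (h x).
Proof.
move=> hc _ [y [C [Cx CO Cc] Cy] <-]; exists (h @` C); last by exists y.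
split; first by exists x.
  exact: image_subset.
by apply: connected_continuous_connected Cc _; exact: continuous_subspaceT.
Qed.

Lemma connected_component_f (O : set S) x :
  connected_component (f @` O) (f x) = f @` connected_component O x.
Proof.
apply: image_eq; first exact: connected_component_image.
by have := @connected_component_image g (f @` O) (f x) gc; rewrite image_gf fK.
Qed.

Lemma components_f (O : set S) C : components O C -> components (f @` O) (f @` C).
Proof.
move=> [x Ox ->]; exists (f x); first by exists x.
by rewrite connected_component_f.
Qed.

Lemma components_fE (O : set S) C : components (f @` O) C ->
  exists2 D, components O D & C = f @` D.
Proof.
move=> [_ [x Ox <-] ->]; exists (connected_component O x); first by exists x.
by rewrite connected_component_f.
Qed.

Definition has_components (O : set S) (n : nat) : Prop :=
  exists c : 'I_n -> set S, enumerates c (components O).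

Lemma has_components_f (O : set S) n : has_components O n <-> has_components (f @` O) n.
Proof.
split=> [[c [ci cr]]|[c [ci cr]]].
  exists (fun i => f @` c i); split.
    by move=> i j /(congr1 (fun B => g @` B)); rewrite !image_gf => /ci.
  apply/seteqP; split=> [_ [i _ <-]|C /components_fE[D DO ->]].
    by apply: components_f; rewrite -cr; exists i.
  by move: DO; rewrite -cr => -[i _ <-]; exists i.
exists (fun i => g @` c i); split.
  by move=> i j /(congr1 (fun B => f @` B)); rewrite !image_fg => /ci.
apply/seteqP; split=> [_ [i _ <-]|C /components_f].
  have : components (f @` O) (c i) by rewrite -cr; exists i.
  by move=> /components_fE[D DO ->]; rewrite image_gf.
by rewrite -cr => -[i _ ic]; exists i => //; rewrite ic image_gf.
Qed.

(** [U] stands for the union of the interiors of all rectangles, so [n] is a possible entry [h_i],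
    expressed without labels or directions. *)
Definition horizontal_count (U : set S) (n : nat) : Prop :=
  exists2 C, components U C & has_components (C `&` f @^-1` U) n.

Definition vertical_count (U : set S) (n : nat) : Prop :=
  exists2 C, components U C & has_components (C `&` f @` U) n.

Lemma horizontal_count_f U n : horizontal_count (f @` U) n <-> horizontal_count U n.
Proof.
have E C : f @` C `&` f @^-1` (f @` U) = f @` (C `&` f @^-1` U).
  rewrite image_f_setI; congr (_ `&` _); apply/seteqP; split=> x.
    by move=> [y Uy /(can_inj fK) yx]; exists (g x); rewrite /= gK // -yx.
  by move=> [y Uy <-]; exists (f y).
split=> [[_ /components_fE[C CU ->]]|[C CU]].
  by rewrite E -has_components_f; exists C.
by rewrite has_components_f -E => H; exists (f @` C) => //; exact: components_f.
Qed.

Lemma vertical_count_f U n : vertical_count (f @` U) n <-> vertical_count U n.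
Proof.
split=> [[_ /components_fE[C CU ->]]|[C CU]].
  by rewrite -image_f_setI -has_components_f; exists C.
by rewrite has_components_f image_f_setI => H; exists (f @` C) => //; exact: components_f.
Qed.

End Equivariance.

(** * Geometric types of bounded size *)

Section FiniteTypes.

Lemma finite_ffun (I J : finType) (T : choiceType) (u : J -> T) :
  finite_set [set h : {ffun I -> T} | forall i, exists j, h i = u j].
Proof.
have fin : finite_set [set: {ffun I -> J}] by exact: finite_finset.
apply: sub_finite_set (finite_image (fun e : {ffun I -> J} => [ffun i => u (e i)]) fin).
move=> h /choice[e he]; exists (finfun e) => //.
by apply/ffunP => i; rewrite !ffunE he.
Qed.

(** The index types of [rho] and [eps] depend on the sizes, so the types are exhausted by nested
    unions: over the sizes first, then over functions between finite types. *)
Lemma finite_geo_types b : finite_set [set T : geo_type |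
  [/\ (gt_N T <= b)%N, forall i, (gt_h T i <= b)%N, forall k, (gt_v T k <= b)%N &
      forall x, gt_eps T x = 1 \/ gt_eps T x = -1]].
Proof.
pose small N : set {ffun 'I_N -> nat} :=
  [set h | forall i, exists j : 'I_b.+1, h i = val j].
pose signs (X : finType) : set {ffun X -> int} :=
  [set e | forall x, exists s : bool, e x = if s then 1 else -1].
apply: (@sub_finite_set _ _ (\bigcup_(N in `I_b.+1) \bigcup_(h in small N)
  \bigcup_(v in small N) \bigcup_(rho in setT)
  \bigcup_(eps in signs {i : 'I_N & 'I_(h i)})
  [set @GeoType N h v rho eps])).
  move=> [N h v rho eps] /= [Nb hb vb e1].
  exists N; first by rewrite /= ltnS.
  have sm (w : {ffun 'I_N -> nat}) : (forall i, (w i <= b)%N) -> small N w.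
    move=> wb i; have ib : (w i < b.+1)%N by rewrite ltnS.
    by exists (Ordinal ib).
  exists h; first exact: sm.
  exists v; first exact: sm.
  exists rho => //; exists eps => // x.
  by case: (e1 x) => ->; [exists true|exists false].
apply: bigcup_finite => [|N _]; first exact: finite_II.
apply: bigcup_finite => [|h _]; first exact: finite_ffun.
apply: bigcup_finite => [|v _]; first exact: finite_ffun.
apply: bigcup_finite => [|rho _]; first exact: finite_finset.
apply: bigcup_finite => [|eps _]; first exact: finite_ffun.
exact: finite_set1.
Qed.

End FiniteTypes.

Section Counts.
Variables (S : topologicalType) (f : S -> S).

Lemma has_components_le (O : set S) n n' :
  has_components O n -> has_components O n' -> (n <= n')%N.
Proof.
move=> [c [ci cr]] [c' [_ cr']].
have /choice[u Hu] i : exists j, c' j = c i.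
  have : range c' (c i) by rewrite cr' -cr; exists i.
  by move=> [j _ ?]; exists j.
have ui : injective u by move=> i j uij; apply: ci; rewrite -!Hu uij.
by have := leq_card u ui; rewrite !card_ord.
Qed.

Lemma count_bounded (U : set S) N (W : set S) : has_components U N ->
  exists b, forall n, (exists2 C, components U C & has_components (C `&` W) n) ->
    (n <= b)%N.
Proof.
move=> [c [_ cr]].
(* A component has at most one count; [0] is the default bound when its components are not finite in
   number. *)
have /choice[u Hu] (i : 'I_N) : exists b, forall n, has_components (c i `&` W) n -> (n <= b)%N.
  have [[b Hb]|no] := pselect (exists b, has_components (c i `&` W) b).
    by exists b => n Hn; apply: has_components_le Hn Hb.
  by exists 0%N => n Hn; exfalso; apply: no; exists n.
exists (\max_i u i)%N => n [C]; rewrite -cr => -[i _ <-] Hn.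
by apply: leq_trans (leq_bigmax i); exact: Hu.
Qed.

(** Retains only the sizes of a geometric type. Counts are not attached to particular rectangles, so
    the condition is blind to relabeling and depends on [U] only up to [f]. *)
Definition counted_type (U : set S) (T : geo_type) :=
  [/\ has_components U (gt_N T), forall i, horizontal_count f U (gt_h T i),
      forall k, vertical_count f U (gt_v T k) &
      forall x, gt_eps T x = 1 \/ gt_eps T x = -1].

Lemma finite_counted_types U : finite_set (counted_type U).
Proof.
have [[N UN]|no] := pselect (exists N, has_components U N); last first.
  apply: sub_finite_set (finite_set0 _) => T [UN _ _ _].
  by exfalso; apply: no; exists (gt_N T).
have [b Hb] := count_bounded (f @^-1` U) UN.
have [d Hd] := count_bounded (f @` U) UN.
apply: sub_finite_set (finite_geo_types (N + b + d)) => T [TN Th Tv Te]; split=> //.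
- have := has_components_le TN UN; lia.
- by move=> i; have := Hb _ (Th i); lia.
- by move=> k; have := Hd _ (Tv k); lia.
Qed.

End Counts.

Lemma components_cover (S : topologicalType) (O : set S) (I : Type) (c : I -> set S) :
  range c = components O -> \bigcup_i c i = O.
Proof.
move=> cr; apply/seteqP; split=> [x [i _ xi]|x Ox].
  have : components O (c i) by rewrite -cr; exists i.
  by move=> [y _ cE]; move: xi; rewrite cE => /connected_component_sub; apply.
have : components O (connected_component O x) by exists x.
rewrite -cr => -[i _ ci]; exists i => //; rewrite ci.
exact: connected_component_refl.
Qed.

Lemma primitive_counted (R : realType) (S : topologicalType) (A : set (chart R S))
    (f : S -> S) (Fs Fu : S -> set S) (Sg : set S) (n : nat) z T
    (G : 'I_(gt_N T) -> geo_rect R S) :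
  primitive_partition A Fs Fu f Sg z n G -> has_geo_type f G ->
  counted_type f (partition_interior R Fs Fu f Sg n z) T.
Proof.
move=> [_ Gen] [H [V [HH HV _ He]]].
have Gcover : \bigcup_i gr_int (G i) = partition_interior R Fs Fu f Sg n z :=
  components_cover Gen.2.
have Gcomp i : components (partition_interior R Fs Fu f Sg n z) (gr_int (G i)).
  by have [_ <-] := Gen; exists i.
split.
- by exists (fun i => gr_int (G i)).
- move=> i; exists (gr_int (G i)) => //; exists (H i).
  by rewrite -Gcover preimage_bigcup; have [] := HH i.
- move=> k; exists (gr_int (G k)) => //; exists (V k).
  by rewrite -Gcover image_bigcup; have [] := HV k.
- by move=> [i j]; case: (He i j) => -[_ ->]; [left|right].
Qed.

Theorem theorem3 (R : realType) (S : topologicalType) (A : set (chart R S))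
    (f : S -> S) (Fs Fu : S -> set S) (mus muu : set S -> R) (lambda : R)
    (Sg : set S) (nf n : nat)
    (hS : closed_oriented_surface A)
    (hf : generalized_pseudo_anosov A f Fs Fu mus muu lambda)
    (hSg : is_Sing R f Fs Fu Sg)
    (hnf : compatibility_order A Fs Fu f Sg nf)
    (hn : leq nf n) :
  finite_set (primitive_types A Fs Fu f Sg n).
Proof.
have [E [Efin HE]] := first_intersection_orbits hS hf hSg.
have [[[fc [g [gc fK gK]]] _] _ _ fF _] := hf.
have fS x : f @` Fs x = Fs (f x) by case: (fF x).
have fU x : f @` Fu x = Fu (f x) by case: (fF x).
have [_ [_ fSg]] := Sing_finite_invariant hS hf hSg.
have ct_f U T : counted_type f (f @` U) T <-> counted_type f U T.
  split=> -[UN UH UV Ue]; split=> //.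
  - exact: (proj2 (has_components_f fc gc fK gK _ _) UN).
  - by move=> i; apply/(horizontal_count_f fc gc fK gK).
  - by move=> i; apply/(vertical_count_f fc gc fK gK).
  - exact: (proj1 (has_components_f fc gc fK gK _ _) UN).
  - by move=> i; apply/(horizontal_count_f fc gc fK gK).
  - by move=> i; apply/(vertical_count_f fc gc fK gK).
have ct_iter m z T : counted_type f (partition_interior R Fs Fu f Sg n (iter m f z)) T <->
    counted_type f (partition_interior R Fs Fu f Sg n z) T.
  elim: m => // m IH; rewrite iterS (partition_interior_f R fc gc fK gK fS fU fSg).
  by rewrite ct_f.
apply: (@sub_finite_set _ _
  (\bigcup_(y in E) counted_type f (partition_interior R Fs Fu f Sg n y))).
  (* Counted types agree along orbits, so they pass from [z] to [iter a f z = iter b f y] and from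
     there to [y]. *)
  move=> T [z [G [zfi zG TG]]]; have [a [b [y [Ey zy]]]] := HE z zfi.
  exists y => //; apply/(ct_iter b); rewrite -zy; apply/ct_iter.
  exact: primitive_counted zG TG.
by apply: bigcup_finite => // y _; exact: finite_counted_types.
Qed.
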